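(* Let $n\geq 1$, let $\mathbb{P}_n$ be the real $n$-dimensional projective space with a distinguished point $A$, and let $V=T_A\mathbb{P}_n$. The map $\bar\alpha\colon\Phi(\mathbb{P}_n)\to F(V)$, $[\mathcal{R}]\mapsto\varepsilon(\varphi_{\mathcal{R}})$, from the set of $H$-orbits of adapted projective frames to the set of bases of $V$, is an isomorphism of $\bar G$-spaces; that is, $\bar\alpha$ is a (well-defined) diffeomorphism and $\bar\alpha(gH\cdot[\mathcal{R}])=d_Ag\cdot\bar\alpha([\mathcal{R}])$ for all $g\in G$ and all adapted projective frames $\mathcal{R}$.
   Context: Let $V_{n+1}$ be a real vector space of dimension $n+1$, and $\mathbb{P}_n=(V_{n+1}\setminus\{0\})/{\sim}$ the quotient by collinearity, with canonical projection $\pi$. Fix a point $A\in\mathbb{P}_n$. Frames: a projective frame is an ordered set $\mathcal{R}=\{A_0,A_1,\ldots,A_n,E\}$ of $n+2$ points of $\mathbb{P}_n$ such that any $n+1$ of them are in generic position (not contained in a hyperplane). It is adapted if $A_0=A$. $F(\mathbb{P}_n)$ is the manifold of adapted projective frames (an open subset of $(\mathbb{P}_n)^{n+1}$ via $(A_1,\ldots,A_n,E)$). Charts: a basis $\{\vec A_0,\ldots,\vec A_n\}$ of $V_{n+1}$ generates $\mathcal{R}$ if $\pi(\vec A_i)=A_i$ for $i=0,\ldots,n$ and $\pi(\vec A_0+\cdots+\vec A_n)=E$. Homogeneous coordinates $(x^0:\cdots:x^n)$ of a point $M$ with respect to $\mathcal{R}$ are the coordinates, in a basis generating $\mathcal{R}$,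 of a vector $\vec M\in\pi^{-1}(M)$. $U_{\mathcal{R}}$ is the open set $x^0\ne0$, and $\varphi_{\mathcal{R}}\colon U_{\mathcal{R}}\to\mathbb{R}^n$ is the affine chart $M\mapsto(X^1,\ldots,X^n)$, $X^i=x^i/x^0$. If $\mathcal{R}$ is adapted then $A\in U_{\mathcal{R}}$, and $\varepsilon(\varphi_{\mathcal{R}})$ denotes the natural (coordinate) basis $\left(\frac{\partial}{\partial X^1}\big|_A,\ldots,\frac{\partial}{\partial X^n}\big|_A\right)$ of $V=T_A\mathbb{P}_n$ induced by the chart $\varphi_{\mathcal{R}}$. Groups: a projective transformation of $\mathbb{P}_n$ is a map induced by an invertible linear operator on $V_{n+1}$. $G$ is the Lie group of projective transformations fixing $A$; it acts on $F(\mathbb{P}_n)$ by $g\cdot\mathcal{R}=\{g(A_0),\ldots,g(A_n),g(E)\}$. Let $\beta\colon G\to GL(V)$, $\beta(g)=d_Ag$, and $H=\ker\beta$. The map $\beta$ is a Lie group epimorphism, and $\bar G:=G/H$ is identified with $GL(V)$ via $gH\mapsto d_Ag$. Spaces: $\Phi(\mathbb{P}_n)$ is the set of $H$-orbits $[\mathcal{R}]$ in $F(\mathbb{P}_n)$, with the smooth quotient structure for which the projection $p\colon\mathcal{R}\mapsto[\mathcal{R}]$ is a surjective submersion. $\bar G$ acts on it by $gH\cdot[\mathcal{R}]=[g\cdot\mathcal{R}]$. $F(V)$ is the manifold of ordered bases of $V$, on which $\psi\in GL(V)=\bar G$ acts by $\psi\cdot\{\vec e_1,\ldots,\vec e_n\}=\{\psi(\vec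 e_1),\ldots,\psi(\vec e_n)\}$. *)

(* Defs.v *)
From HB Require Import structures.
From mathcomp Require Import all_boot all_order all_algebra.
From mathcomp Require Import all_classical all_reals all_analysis.
Set Implicit Arguments.
Unset Strict Implicit.
Unset Printing Implicit Defensive.
Import Order.TTheory GRing.Theory Num.Theory numFieldNormedType.Exports.
Local Open Scope classical_set_scope.
Local Open Scope ring_scope.

(* [Ck k U f] is meant for open [U] and finite-dimensional [E]. *)
Fixpoint Ck (R : realType) (E F : normedModType R) (k : nat) (U : set E)
    (f : E -> F) : Prop :=
  match k with
  | 0 => forall x, U x -> {for x, continuous f}
  | k'.+1 => (forall x, U x -> differentiable f x) /\
             (forall v : E, Ck k' U ('D_v f))
  end.

Definition smooth_on (R : realType) (E F : normedModType R) (U : set E)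
    (f : E -> F) : Prop :=
  forall k, Ck k U f.

(* Manifolds are subsets [X] of an ambient type [T], described by a set [S] of
   charts with values in a model space [E]; the topology of [X] is the one
   induced by the charts. Charts are total functions whose values outside of
   their domain are irrelevant. *)
Record chart (R : realType) (T : Type) (E : normedModType R) := Chart {
  cdom : set T ;
  cmap :> T -> E }.

HB.instance Definition _ (R : realType) (T : Type) (E : normedModType R) :=
  gen_eqMixin (chart T E).
HB.instance Definition _ (R : realType) (T : Type) (E : normedModType R) :=
  gen_choiceMixin (chart T E).
HB.instance Definition _ (R : realType) (T : Type) (E : normedModType R) :=
  isPointed.Build (chart T E) (@Chart R T E set0 (fun=> 0)).

Definition cinv (R : realType) (T : pointedType) (E : normedModType R)
    (c : chart T E) (x : E) : T :=
  get [set y | cdom c y /\ c y = x].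

Definition mopen (R : realType) (T : Type) (E : normedModType R)
    (X : set T) (S : set (chart T E)) (O : set T) : Prop :=
  O `<=` X /\ forall c, S c -> open (c @` (O `&` cdom c)).

Definition smooth_atlas (R : realType) (T : pointedType) (E : normedModType R)
    (X : set T) (S : set (chart T E)) : Prop :=
  [/\ forall x, X x -> exists2 c, S c & cdom c x,
      forall c, S c -> cdom c `<=` X /\ set_inj (cdom c) c &
      forall c d, S c -> S d ->
        let U := c @` (cdom c `&` cdom d) in
        open U /\ smooth_on U (d \o cinv c)].

Definition smooth_manifold (R : realType) (T : pointedType)
    (E : normedModType R) (X : set T) (S : set (chart T E)) : Prop :=
  [/\ smooth_atlas X S,
      forall x y, X x -> X y -> x <> y -> exists O O' : set T,
        [/\ mopen X S O, mopen X S O', O x, O' y & O `&` O' = set0] &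
      exists B : set (set T), [/\ countable B, B `<=` mopen X S &
        forall O x, mopen X S O -> O x ->
          exists2 U, B U & U x /\ U `<=` O]].

Section Maps.
Variables (R : realType) (T T' : pointedType) (E E' : normedModType R).
Variables (X : set T) (S : set (chart T E)).
Variables (X' : set T') (S' : set (chart T' E')).

Definition loc (c : chart T E) (d : chart T' E') (f : T -> T') : E -> E' :=
  d \o f \o cinv c.

(* Openness of the domains of the local expressions is the continuity of [f]. *)
Definition smooth_map (f : T -> T') : Prop :=
  set_fun X X' f /\
  forall c d, S c -> S' d ->
    let U := c @` (cdom c `&` f @^-1` cdom d) in
    open U /\ smooth_on U (loc c d f).

Definition submersion (f : T -> T') : Prop :=
  smooth_map f /\
  forall x c d, X x -> S c -> S' d -> cdom c x -> cdom d (f x) ->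
    forall w : E', exists v : E, 'd (loc c d f) (c x) v = w.

End Maps.

Definition diffeomorphism (R : realType) (T T' : pointedType)
    (E E' : normedModType R) (X : set T) (S : set (chart T E))
    (X' : set T') (S' : set (chart T' E')) (f : T -> T') : Prop :=
  smooth_map X S X' S' f /\
  exists g : T' -> T,
    [/\ smooth_map X' S' X S g, {in X, cancel f g} & {in X', cancel g f}].

(* A tangent vector at [a] is the family of its coordinates in all the charts
   at [a], related by the differentials of the changes of charts; the family
   is set to 0 at the other charts, so that it is uniquely determined. *)
Section Tangent.
Variables (R : realType) (T : pointedType) (E : normedModType R).
Variables (S : set (chart T E)) (a : T).

Definition charts_at : set (chart T E) := [set c | S c /\ cdom c a].

Definition tangent_space : set (chart T E -> E) :=
  [set xi | (forall c d, charts_at c -> charts_at d ->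
               xi d = 'd (d \o cinv c) (c a) (xi c)) /\
            (forall c, ~ charts_at c -> xi c = 0)].

(* the tangent vector with coordinates [w] in the chart [c] *)
Definition tangent_of (c : chart T E) (w : E) : chart T E -> E :=
  fun d => if `[< charts_at d >] then 'd (d \o cinv c) (c a) w else 0.

End Tangent.

(* The chart at the source is arbitrary: the result does not depend on it. *)
Definition tangent_map (R : realType) (T T' : pointedType)
    (E E' : normedModType R) (S : set (chart T E)) (S' : set (chart T' E'))
    (a : T) (f : T -> T') (xi : chart T E -> E) : chart T' E' -> E' :=
  let c := get (charts_at S a) in
  fun d => if `[< charts_at S' (f a) d >]
           then 'd (loc c d f) (c a) (xi c) else 0.

Section Projective.
Variables (R : realType) (n : nat) (V : vectType R).

(* Points are classes of nonzero vectors modulo collinearity. *)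
Definition pt (v : V) : set V := [set w | exists2 k : R, k != 0 & w = k *: v].

Definition Pn : set (set V) := [set M | exists2 v : V, v != 0 & M = pt v].

(* [A_0, ..., A_n, E], the unit point [E] being at index [ord_max] *)
Definition frame := 'I_n.+2 -> set V.

Definition projective_frame (r : frame) : Prop :=
  (forall i, Pn (r i)) /\
  forall j, ~ exists2 W : {vspace V}, \dim W = n &
    forall i, i != j -> r i `<=` [set v | v \in W].

Definition generates (b : n.+1.-tuple V) (r : frame) : Prop :=
  [/\ basis_of fullv b,
      forall i : 'I_n.+1, pt (tnth b i) = r (widen_ord (leqnSn n.+1) i) &
      pt (\sum_(i < n.+1) tnth b i) = r ord_max].

(* The generating basis and the representative of [M] are arbitrary: the
   homogeneous coordinates are defined up to a common nonzero factor. *)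
Definition hcoord (r : frame) (M : set V) (i : 'I_n.+1) : R :=
  coord (xget [tuple (0 : V) | _ < n.+1] [set b | generates b r]) i (xget 0 M).

Definition affine_chart (r : frame) : chart (set V) 'rV[R]_n :=
  Chart [set M | Pn M /\ hcoord r M ord0 != 0]
    (fun M => \row_(i < n) (hcoord r M (lift ord0 i) / hcoord r M ord0)).

Definition Pn_charts : set (chart (set V) 'rV[R]_n) :=
  [set affine_chart r | r in projective_frame].

Definition proj_transformation (g : set V -> set V) : Prop :=
  exists2 L : 'End(V), lker L == 0%VS &
    forall v : V, v != 0 -> g (pt v) = pt (L v).

Variable A : set V.

Definition tangentA := chart (set V) 'rV[R]_n -> 'rV[R]_n.

Definition TA : set tangentA := tangent_space Pn_charts A.

(* Adapted frames, with the charts of the open subset of [(P_n)^(n+1)] given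
   by [(A_1, ..., A_n, E)]: row [j] holds affine coordinates, with respect to
   the frame [q j], of the point of index [j + 1]. *)
Definition FP : set frame := [set r | projective_frame r /\ r ord0 = A].

Definition FP_chart (q : 'I_n.+1 -> frame) : chart frame 'M[R]_(n.+1, n) :=
  Chart
    [set r | FP r /\ forall j, cdom (affine_chart (q j)) (r (lift ord0 j))]
    (fun r => \matrix_(j < n.+1) affine_chart (q j) (r (lift ord0 j))).

Definition FP_charts : set (chart frame 'M[R]_(n.+1, n)) :=
  [set FP_chart q | q in [set q | forall j, projective_frame (q j)]].

Definition G : set (set V -> set V) :=
  [set g | proj_transformation g /\ g A = A].

Definition dA (g : set V -> set V) : tangentA -> tangentA :=
  tangent_map Pn_charts Pn_charts A g.

Definition H : set (set V -> set V) :=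
  [set g | G g /\ forall xi, TA xi -> dA g xi = xi].

Definition frame_act (g : set V -> set V) (r : frame) : frame := fun i => g (r i).

Definition Horbit (r : frame) : set frame := [set frame_act h r | h in H].

Definition Phi : set (set frame) := [set Horbit r | r in FP].

(* Smooth structures on the topological quotient [Phi] for which the
   projection is a surjective submersion; [n ^ 2] is the dimension of [Phi]. *)
Definition quotient_structure (S : set (chart (set frame) 'M[R]_n)) : Prop :=
  [/\ smooth_manifold Phi S,
      forall O, O `<=` Phi ->
        (mopen Phi S O <-> mopen FP FP_charts (FP `&` Horbit @^-1` O)),
      set_surj FP Phi Horbit &
      submersion FP FP_charts Phi S Horbit].

Definition FV : set ('I_n -> tangentA) :=
  [set e | (forall i, TA (e i)) /\
           forall xi, TA xi ->
             exists! x : 'rV[R]_n, xi = \sum_(i < n) x ord0 i *: e i].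

Definition coords (e : 'I_n -> tangentA) (xi : tangentA) : 'rV[R]_n :=
  get [set x : 'rV[R]_n | xi = \sum_(i < n) x ord0 i *: e i].

(* global charts: the matrix of a basis with respect to a reference basis *)
Definition FV_chart (e : 'I_n -> tangentA) :
    chart ('I_n -> tangentA) 'M[R]_n :=
  Chart FV (fun f => \matrix_(i < n) coords e (f i)).

Definition FV_charts : set (chart ('I_n -> tangentA) 'M[R]_n) :=
  [set FV_chart e | e in FV].

Definition eps (r : frame) : 'I_n -> tangentA :=
  fun i => tangent_of Pn_charts A (affine_chart r) (delta_mx ord0 i).

End Projective.

Arguments Pn {R V}.
Arguments G {R V} A.
Arguments dA {R} n {V} A g.
Arguments Phi {R} n {V} A.
Arguments FV {R} n {V} A.
Arguments FV_charts {R} n {V} A.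

(* Main.v *)
(* Choose a basis of V whose first vector spans A. An adapted frame has a unique
   generating basis whose first vector is that one, and its matrix is then the
   block matrix with rows (1, 0) and (t, W), with W invertible. The transition
   maps of the affine charts are fractional linear, and the matrix of eps r
   in the coordinates of the reference chart is exactly W, while H acts simply
   transitively on the parameter t. So the H-orbits are the fibres of eps, and
   W identifies both Phi and F(V) with GL_n.

   For an arbitrary quotient structure on Phi, the map W |-> [r] is smooth
   because r |-> W has smooth global sections; it is a homeomorphism onto Phi by
   the quotient topology, and its differential is onto because the projection is
   a submersion. A homeomorphism between open sets which is smooth with
   invertible differential has a smooth inverse, so the implicit function
   theorem is not needed. *)
From HB Require Import structures.
Require Import Defs.
From mathcomp Require Import all_boot all_order all_algebra.
From mathcomp Require Import all_classical all_reals all_analysis.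
Set Implicit Arguments.
Unset Strict Implicit.
Unset Printing Implicit Defensive.
Import Order.TTheory GRing.Theory Num.Theory numFieldNormedType.Exports.
Local Open Scope classical_set_scope.
Local Open Scope ring_scope.

(** * Smooth maps *)

(** Vectors are rows and matrices act from the right. The parameter t is invisible in [eps r]
    because it enters only the denominator 1 + x t of a transition map whose numerator x W vanishes
    at the coordinates of A. The matrices of the elements of H are never computed: membership in H
    is read off from the effect of the differential on one basis of the tangent space.

    The main obstacle is that the charts of the frame space do not display t and W: they record the
    points A_1, ..., A_n, E separately, each in an affine chart of its own. The generating basis has
    to be recovered from the linear relation between representatives of A, A_1, ..., A_n, E, which
    makes W a rational function of the coordinates.

    Surjectivity of the differential passes from the orbit projection to its outer factor, the map W
    |-> [r]. Charts of Phi have values in n by n matrices, so this differential is an endomorphism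
    and surjectivity makes it invertible. The quotient structure being arbitrary, the existence of
    one is proved separately, with W as single global chart. *)

Section NearEq.
Context {R : realType} {E F : normedModType R}.
Implicit Types f g : E -> F.

(** Chart inverses take arbitrary values off the image of the chart, so local expressions agree with
    closed formulas only near a point. The first-order expansion of [f] is also one of [g], and the
    differential is unique. *)
Lemma near_eq_diff f g x : (\forall y \near x, f y = g y) ->
  differentiable f x -> differentiable g x /\ 'd g x = 'd f x :> (E -> F).
Proof.
move=> fg df; have [dfc] := (diff_locallyP x f).1 df.
move=> dfx.
have gx : g \o shift x = cst (g x) + 'd f x +o_ 0 id.
  apply/eqaddoP => _/posnumP[e].
  move/eqaddoP : dfx => /(_ e%:num (gt0 e)) dfx.
  have fgx := nbhs_singleton fg.
  have fg0 : \forall h \near 0, f (h + x) = g (h + x).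
    have := fg; rewrite (near_shift 0 x) /= => fg'.
    by apply: filterS fg' => h /=; rewrite subr0.
  near=> h.
  have fgh : f (h + x) = g (h + x) by near: h.
  have : `|(f \o shift x - (cst (f x) + 'd f x)) h| <= e%:num * `|id h| by near: h.
  by rewrite !fctE /= fgh fgx.
have dE := diff_unique dfc gx.
split; last exact: dE.
apply/diff_locallyP; rewrite dE; split; [exact: dfc|exact: gx].
Unshelve. all: by end_near. Qed.

Lemma near_eq_differentiable f g x : (\forall y \near x, f y = g y) ->
  differentiable f x -> differentiable g x.
Proof. by move=> fg /(near_eq_diff fg)[]. Qed.

End NearEq.

Section Ck.
Context {R : realType}.

Lemma Ck_sub (E F : normedModType R) k (U W : set E) (f : E -> F) :
  W `<=` U -> Ck k U f -> Ck k W f.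
Proof.
move=> WU; elim: k f => [|k IH] f /=; first by move=> h x /WU/h.
by move=> [h1 h2]; split => [x /WU/h1//|v]; exact/IH/h2.
Qed.

Lemma CkW (E F : normedModType R) k (U : set E) (f : E -> F) :
  Ck k.+1 U f -> Ck k U f.
Proof.
elim: k f => [|k IH] f; first by move=> [h _] x /h/differentiable_continuous.
by move=> [h1 h2]; split => // v; apply: IH.
Qed.

Lemma Ck_eq (E F : normedModType R) k (U : set E) (f g : E -> F) :
  open U -> {in U, f =1 g} -> Ck k U f -> Ck k U g.
Proof.
move=> oU; elim: k f g => [|k IH] f g fg /=.
  move=> h x Ux; have /h := Ux.
  rewrite /prop_for /continuous_at -(fg x) ?inE// => hf; apply: cvg_trans hf.
  apply: near_eq_cvg; have := open_nbhs_nbhs (conj oU Ux).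
  by apply: filterS => y Uy; rewrite fg// inE.
move=> [h1 h2].
have near_fg x : U x -> \forall y \near x, f y = g y.
  move=> Ux; have := open_nbhs_nbhs (conj oU Ux).
  by apply: filterS => y Uy; rewrite fg// inE.
split=> [x Ux|v].
  by apply: near_eq_differentiable (h1 x Ux); exact: near_fg.
apply: IH (h2 v) => x; rewrite inE => Ux.
exact/near_eq_derive/near_fg.
Qed.

Lemma Ck_cst (E F : normedModType R) k (U : set E) (c : F) :
  Ck k U (fun=> c : F).
Proof.
elim: k c => [|k IH] c /=; first by move=> x _; apply: cvg_cst.
split=> [x _|v]; first exact: differentiable_cst.
rewrite (_ : 'D_v _ = fun=> 0); first exact: IH.
by apply/funext => x; exact: derive_cst.
Qed.

Lemma Ck_lin (E F F' : normedModType R) k (U : set E) (f : E -> F)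
    (l : {linear F -> F'}) : open U -> continuous l ->
  Ck k U f -> Ck k U (l \o f).
Proof.
move=> oU lc; elim: k f => [|k IH] f /=.
  by move=> h x Ux; apply: continuous_comp; [exact: h|exact: lc].
move=> [h1 h2]; split=> [x Ux|v].
  by apply: differentiable_comp; [exact: h1|exact: linear_differentiable].
apply: Ck_eq (IH _ (h2 v)) => // x; rewrite inE => Ux /=.
have dl := linear_differentiable (f x) lc.
have df := h1 x Ux.
rewrite (deriveE _ df) (deriveE _ (differentiable_comp df dl)).
by rewrite (diff_comp df dl) /= (diff_lin _ lc).
Qed.

Lemma Ck_linear (E F : normedModType R) k (U : set E) (l : {linear E -> F}) :
  continuous l -> Ck k U l.
Proof.
move=> lc; case: k => [|k] /=; first by move=> x _; exact: lc.
split=> [x _|v]; first exact: linear_differentiable.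
rewrite (_ : 'D_v _ = fun=> l v); first exact: Ck_cst.
apply/funext => x; rewrite deriveE ?diff_lin//.
exact: linear_differentiable.
Qed.

Lemma CkD (E F : normedModType R) k (U : set E) (f g : E -> F) : open U ->
  Ck k U f -> Ck k U g -> Ck k U (f + g).
Proof.
move=> oU; elim: k f g => [|k IH] f g /=.
  by move=> hf hg x Ux; apply: continuousD; [exact: hf|exact: hg].
move=> [f1 f2] [g1 g2]; split=> [x Ux|v].
  by apply: differentiableD; [exact: f1|exact: g1].
apply: Ck_eq (IH _ _ (f2 v) (g2 v)) => // x; rewrite inE => Ux.
by rewrite deriveD//; apply: diff_derivable; [exact: f1|exact: g1].
Qed.

Lemma Ck_sum (E F : normedModType R) k (U : set E) (I : Type) (r : seq I)
    (P : pred I) (f : I -> E -> F) : open U ->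
  (forall i, P i -> Ck k U (f i)) -> Ck k U (fun x => \sum_(i <- r | P i) f i x).
Proof.
move=> oU h; rewrite -(@fct_sumE _ _ _ _ P f).
apply: (big_ind (fun f => Ck k U f)) => //; first exact: Ck_cst.
by move=> ? ?; exact: CkD.
Qed.

Lemma CkM (E : normedModType R) k (U : set E) (f g : E -> R) : open U ->
  Ck k U f -> Ck k U g -> Ck k U (fun x => f x * g x).
Proof.
move=> oU; elim: k f g => [|k IH] f g.
  by move=> hf hg x Ux; apply: continuousM; [exact: hf|exact: hg].
move=> hf hg; have [[f1 f2] [g1 g2]] := (hf, hg).
split=> [x Ux|v].
  by apply: differentiableM; [exact: f1|exact: g1].
apply: Ck_eq (CkD _ (IH _ _ (CkW hf) (g2 v)) (IH _ _ (CkW hg) (f2 v))) => //.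
move=> x; rewrite inE => Ux.
have df : derivable f x v := diff_derivable (f1 x Ux).
have dg : derivable g x v := diff_derivable (g1 x Ux).
by rewrite (deriveM df dg).
Qed.

Lemma CkV (E : normedModType R) k (U : set E) (f : E -> R) : open U ->
  (forall x, U x -> f x != 0) ->
  Ck k U f -> Ck k U (fun x => (f x)^-1).
Proof.
move=> oU f0; elim: k f f0 => [|k IH] f f0.
  by move=> hf x Ux; apply: continuousV; [exact: f0|exact: hf].
move=> hf; have [f1 f2] := hf; have fV := IH _ f0 (CkW hf).
split=> [x Ux|v]; first by apply: differentiableV; [exact: f1|exact: f0].
apply: Ck_eq (CkM oU (CkM oU (Ck_cst _ _ (-1 : R)) (CkM oU fV fV)) (f2 v)) => //.
move=> x; rewrite inE => Ux; rewrite (deriveV (f0 x Ux) (diff_derivable (f1 x Ux))).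
by rewrite -[RHS]/(_ * _) mulN1r -expr2 exprVn.
Qed.

Definition entry p q i j (M : 'M[R]_(p, q)) : R := M i j.

Fact entry_is_linear p q i j : linear (@entry p q i j).
Proof. by move=> a M N; rewrite /entry !mxE. Qed.
HB.instance Definition _ p q i j :=
  GRing.isLinear.Build _ _ _ _ (@entry p q i j) (@entry_is_linear p q i j).

Lemma Ck_entry (E : normedModType R) k (U : set E) p q (f : E -> 'M[R]_(p, q)) i j :
  open U -> Ck k U f -> Ck k U (fun x => f x i j).
Proof.
by move=> oU hf; apply: (Ck_lin (l := @entry p q i j)) => //; exact: coord_continuous.
Qed.

Lemma Ck_mx (E : normedModType R) k (U : set E) p q (f : E -> 'M[R]_(p, q)) :
  open U -> (forall i j, Ck k U (fun x => f x i j : R)) -> Ck k U f.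
Proof.
move=> oU hf.
rewrite (_ : f = fun x => \sum_i \sum_j f x i j *: delta_mx i j); last first.
  by apply/funext => x; exact: matrix_sum_delta.
apply: Ck_sum => // i _; apply: Ck_sum => // j _.
pose l := *:%R^~ (delta_mx i j : 'M[R]_(p, q)).
have lin : linear (l : R -> _) by move=> a u v; rewrite /l scalerDl scalerA.
pose lL : {linear _ -> _} := HB.pack l (GRing.isLinear.Build _ _ _ _ _ lin).
apply: (Ck_lin (l := lL)) => //; exact: scalel_continuous.
Qed.

Lemma mx_linear_continuous p q (F : normedModType R)
  (l : {linear 'M[R]_(p, q) -> F}) : continuous l.
Proof.
rewrite (_ : (l : _ -> _) = fun M => \sum_i \sum_j M i j *: l (delta_mx i j)).
  move=> M; apply: (_ : Ck 0 setT _) => //.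
  apply: Ck_sum => [|i _]; first exact: openT.
  apply: Ck_sum => [|j _ N _]; first exact: openT.
  apply: continuousZr_tmp; exact: (@coord_continuous R p q i j N).
apply/funext => M; rewrite {1}(matrix_sum_delta M) linear_sum; apply: eq_bigr => i _.
by rewrite linear_sum; apply: eq_bigr => j _; rewrite linearZ.
Qed.

(** ['D_v (g \o f) x] is the derivative of [g] in the direction ['D_v f x], which varies with [x],
    whereas [Ck] iterates derivatives in fixed directions. Expanding this direction along the
    [delta_mx i j] gives a sum of products to which the induction applies. *)
Lemma Ck_comp_scalar (E : normedModType R) k p q (U : set E)
    (W : set 'M[R]_(p, q)) (f : E -> 'M[R]_(p, q)) (g : 'M[R]_(p, q) -> R) :
  open U -> open W -> (forall x, U x -> W (f x)) ->
  Ck k U f -> Ck k W g -> Ck k U (g \o f).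
Proof.
move=> oU oW fUW; elim: k f g fUW => [|k IH] f g fUW.
  move=> hf hg x Ux; apply: continuous_comp; first exact: hf.
  by apply: hg; exact: fUW.
move=> hf hg; have [[f1 f2] [g1 g2]] := (hf, hg).
split=> [x Ux|v].
  by apply: differentiable_comp; [exact: f1|apply: g1; exact: fUW].
pose d x := \sum_i \sum_j 'D_v f x i j * ('D_(delta_mx i j) g \o f) x.
apply: (@Ck_eq _ _ _ _ d) => //.
  move=> x; rewrite inE => Ux.
  have df := f1 x Ux; have dg := g1 _ (fUW x Ux).
  rewrite (deriveE _ (differentiable_comp df dg)) (diff_comp df dg) /=.
  rewrite -(deriveE _ df) [in RHS](matrix_sum_delta ('D_v f x)) linear_sum.
  apply: eq_bigr => i _; rewrite linear_sum; apply: eq_bigr => j _.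
  by rewrite linearZ /= (deriveE _ dg).
apply: Ck_sum => // i _; apply: Ck_sum => // j _.
apply: CkM => //; first exact: Ck_entry (f2 v).
by apply: IH => //; [exact: CkW|exact: g2].
Qed.

Lemma Ck_comp (E : normedModType R) k p q p' q' (U : set E)
    (W : set 'M[R]_(p, q)) (f : E -> 'M[R]_(p, q))
    (g : 'M[R]_(p, q) -> 'M[R]_(p', q')) :
  open U -> open W -> (forall x, U x -> W (f x)) ->
  Ck k U f -> Ck k W g -> Ck k U (g \o f).
Proof.
move=> oU oW fUW hf hg; apply: Ck_mx => // i j.
exact: (Ck_comp_scalar oU oW fUW hf (Ck_entry _ _ oW hg)).
Qed.

End Ck.

(** * Smoothness at a point *)

Section SmoothAt.
Context {R : realType}.

Definition smooth_at (E F : normedModType R) (x : E) (f : E -> F) :=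
  exists U : set E, [/\ open U, U x & smooth_on U f].

(** ['D_v f] is a total function, so at every order the condition on [U] splits into conditions at
    the single points of [U], and the neighbourhoods found at these points need not be uniform. *)
Lemma smooth_onP (E F : normedModType R) (U : set E) (f : E -> F) : open U ->
  smooth_on U f <-> forall x, U x -> smooth_at x f.
Proof.
move=> oU; split=> [h x Ux|h]; first by exists U.
have Ck1 k (W : set E) (g : E -> F) :
    Ck k W g <-> (forall x, W x -> Ck k [set x] g).
  split=> [hg x Wx|]; first by apply: Ck_sub hg => _ ->.
  elim: k g => [|k IH] g hg; first by move=> x Wx; exact: (hg x Wx).
  split=> [x Wx|v]; first by have [+ _] := hg x Wx; apply.
  by apply: IH => x Wx; have [_] := hg x Wx; exact.
move=> k; apply/Ck1 => x Ux; have [W [oW Wx hW]] := h x Ux.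
by apply: Ck_sub (hW k) => _ ->.
Qed.

Lemma smooth_at_differentiable (E F : normedModType R) (x : E) (f : E -> F) :
  smooth_at x f -> differentiable f x.
Proof. by move=> [U [_ Ux /(_ 1%N)[+ _]]]; apply. Qed.

Lemma smooth_at_continuous (E F : normedModType R) (x : E) (f : E -> F) :
  smooth_at x f -> {for x, continuous f}.
Proof. by move=> /smooth_at_differentiable/differentiable_continuous. Qed.

Lemma near_open (E : topologicalType) (x : E) (P : set E) :
  (\forall y \near x, P y) -> exists U : set E, [/\ open U, U x & U `<=` P].
Proof.
move=> h; have {h} : nbhs x P by exact: h.
by rewrite nbhsE => -[U [oU Ux] UP]; exists U.
Qed.

Lemma smooth_at_eq (E F : normedModType R) (x : E) (f g : E -> F) :
  (\forall y \near x, f y = g y) -> smooth_at x f -> smooth_at x g.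
Proof.
move=> /near_open[W [oW Wx fg]] [U [oU Ux h]].
exists (U `&` W); split=> [|//|k]; first exact: openI.
apply: (Ck_eq (f := f)); first exact: openI.
  by move=> y; rewrite inE => -[_ /fg].
by apply: Ck_sub (h k) => y [].
Qed.

Lemma smooth_at_op2 (E F1 F2 F : normedModType R)
    (op : (E -> F1) -> (E -> F2) -> (E -> F)) x f g :
  (forall k U f g, open U -> Ck k U f -> Ck k U g -> Ck k U (op f g)) ->
  smooth_at x f -> smooth_at x g -> smooth_at x (op f g).
Proof.
move=> hop [U [oU Ux hU]] [W [oW Wx hW]].
exists (U `&` W); split=> [|//|k]; first exact: openI.
by apply: hop; [exact: openI|apply: Ck_sub (hU k) => ? []|apply: Ck_sub (hW k) => ? []].
Qed.

Lemma smooth_at_cst (E F : normedModType R) (x : E) (c : F) :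
  smooth_at x (fun=> c).
Proof. by exists setT; split=> // [|k]; [exact: openT|exact: Ck_cst]. Qed.

Lemma smooth_at_linear (E F : normedModType R) (x : E) (l : {linear E -> F}) :
  continuous l -> smooth_at x l.
Proof. by exists setT; split=> // [|k]; [exact: openT|exact: Ck_linear]. Qed.

Lemma smooth_at_id (E : normedModType R) (x : E) : smooth_at x id.
Proof. by apply: (@smooth_at_linear E E x idfun) => y; exact: cvg_id. Qed.

Lemma smooth_at_lin (E F F' : normedModType R) (x : E) (f : E -> F)
    (l : {linear F -> F'}) :
  continuous l -> smooth_at x f -> smooth_at x (l \o f).
Proof. by move=> lc [U [oU Ux hU]]; exists U; split=> // k; exact: Ck_lin. Qed.

Lemma smooth_atD (E F : normedModType R) (x : E) (f g : E -> F) :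
  smooth_at x f -> smooth_at x g -> smooth_at x (fun y => f y + g y).
Proof.
by apply: (smooth_at_op2 (op := fun f g y => f y + g y)) => *; exact: CkD.
Qed.

Lemma smooth_atM (E : normedModType R) (x : E) (f g : E -> R) :
  smooth_at x f -> smooth_at x g -> smooth_at x (fun y => f y * g y).
Proof.
by apply: (@smooth_at_op2 E R R R (fun f g y => f y * g y)) => *; exact: CkM.
Qed.

Lemma smooth_atV (E : normedModType R) (x : E) (f : E -> R) : f x != 0 ->
  smooth_at x f -> smooth_at x (fun y => (f y)^-1).
Proof.
move=> fx0 sf.
have : \forall y \near x, f y != 0.
  exact: (smooth_at_continuous sf) (open_nbhs_nbhs (conj (@open_neq R 0) fx0)).
move=> /near_open[W [oW Wx f0]]; have [U [oU Ux h]] := sf.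
have oUW := openI oU oW.
exists (U `&` W); split=> [|//|k]; first exact: openI.
by apply: CkV => // [y [_ /f0]//|]; apply: Ck_sub (h k) => ? [].
Qed.

Lemma smooth_at_sum (E F : normedModType R) (x : E) (I : Type) (r : seq I)
    (P : pred I) (f : I -> E -> F) :
  (forall i, P i -> smooth_at x (f i)) ->
  smooth_at x (fun y => \sum_(i <- r | P i) f i y).
Proof.
move=> h; rewrite -(@fct_sumE _ _ _ _ P f).
apply: (big_ind (fun f => smooth_at x f)) => //; first exact: smooth_at_cst.
by move=> ? ?; exact: smooth_atD.
Qed.

Lemma smooth_at_prod (E : normedModType R) (x : E) (I : Type) (r : seq I)
    (P : pred I) (f : I -> E -> R) :
  (forall i, P i -> smooth_at x (f i)) ->
  smooth_at x (fun y => \prod_(i <- r | P i) f i y).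
Proof.
move=> h; elim: r => [|i r IH].
  under eq_fun do rewrite big_nil.
  exact: smooth_at_cst.
under eq_fun do rewrite big_cons.
by move: (h i); case: (P i) => [hi|_] //; apply: smooth_atM => //; exact: hi.
Qed.

Lemma smooth_at_entry (E : normedModType R) (x : E) p q
    (f : E -> 'M[R]_(p, q)) i j :
  smooth_at x f -> smooth_at x (fun y => f y i j).
Proof. by move=> [U [oU Ux h]]; exists U; split=> // k; exact: Ck_entry. Qed.

Lemma smooth_at_mx (E : normedModType R) (x : E) p q (f : E -> 'M[R]_(p, q)) :
  (forall i j, smooth_at x (fun y => f y i j : R)) -> smooth_at x f.
Proof.
move=> h.
rewrite (_ : f = fun x => \sum_i \sum_j f x i j *: delta_mx i j); last first.
  by apply/funext => y; exact: matrix_sum_delta.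
apply: smooth_at_sum => // i _; apply: smooth_at_sum => // j _.
pose l := *:%R^~ (delta_mx i j : 'M[R]_(p, q)).
have lin : linear (l : R -> _) by move=> a u v; rewrite /l scalerDl scalerA.
pose lL : {linear _ -> _} := HB.pack l (GRing.isLinear.Build _ _ _ _ _ lin).
apply: (smooth_at_lin (l := lL)) => //; exact: scalel_continuous.
Qed.

Lemma smooth_at_mul (E : normedModType R) (x : E) p q r
    (f : E -> 'M[R]_(p, q)) (g : E -> 'M[R]_(q, r)) :
  smooth_at x f -> smooth_at x g -> smooth_at x (fun y => f y *m g y).
Proof.
move=> hf hg; apply: smooth_at_mx => i j.
under eq_fun do rewrite mxE.
by apply: smooth_at_sum => k _; apply: smooth_atM; exact: smooth_at_entry.
Qed.

Lemma smooth_at_scale (E : normedModType R) (x : E) p q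
    (f : E -> R) (g : E -> 'M[R]_(p, q)) :
  smooth_at x f -> smooth_at x g -> smooth_at x (fun y => f y *: g y).
Proof.
move=> hf hg; apply: smooth_at_mx => i j.
under eq_fun do rewrite mxE.
by apply: smooth_atM => //; exact: smooth_at_entry.
Qed.

Lemma smooth_at_det (E : normedModType R) (x : E) p (f : E -> 'M[R]_p) :
  smooth_at x f -> smooth_at x (fun y => \det (f y)).
Proof.
move=> hf; apply: smooth_at_sum => s _; apply: smooth_atM.
  exact: smooth_at_cst.
by apply: smooth_at_prod => i _; exact: smooth_at_entry.
Qed.

Lemma near_unitmx (E : topologicalType) (x : E) p (f : E -> 'M[R]_p) :
  {for x, continuous f} -> f x \in unitmx -> \forall y \near x, f y \in unitmx.
Proof.
move=> cf; rewrite unitmxE unitfE => d0.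
suff : \forall y \near x, \det (f y) != 0.
  by apply: filterS => y; rewrite unitmxE unitfE.
have cd : {for f x, continuous (fun M : 'M[R]_p => \det M : R)}.
  by apply/smooth_at_continuous/smooth_at_det/smooth_at_id.
have cdf : {for x, continuous (fun y => \det (f y))} by exact: continuous_comp cf cd.
exact: cdf (open_nbhs_nbhs (conj (@open_neq R 0) d0)).
Qed.

Lemma open_unitmx p : open [set M : 'M[R]_p | M \in unitmx].
Proof.
rewrite openE => M /= Mu; apply: (near_unitmx (f := id)) => //.
Qed.

(** Cramer's formula. It is only a local equality, since [invmx] is the identity on singular
    matrices. *)
Lemma smooth_at_invmx (E : normedModType R) (x : E) p (f : E -> 'M[R]_p) :
  f x \in unitmx -> smooth_at x f -> smooth_at x (fun y => invmx (f y)).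
Proof.
move=> fx hf.
apply: (smooth_at_eq (f := fun y => (\det (f y))^-1 *: \adj (f y))).
  apply: filterS (near_unitmx (smooth_at_continuous hf) fx) => y fy.
  by rewrite /invmx fy.
apply: smooth_at_scale.
  apply: smooth_atV; last exact: smooth_at_det.
  by rewrite -unitfE -unitmxE.
apply: smooth_at_mx => i j; under eq_fun do rewrite mxE.
apply: smooth_atM; first exact: smooth_at_cst.
apply: smooth_at_det; apply: smooth_at_mx => k l.
by under eq_fun do rewrite !mxE; exact: smooth_at_entry.
Qed.

Lemma smooth_at_comp (E : normedModType R) (x : E) p q p' q'
    (f : E -> 'M[R]_(p, q)) (g : 'M[R]_(p, q) -> 'M[R]_(p', q')) :
  smooth_at x f -> smooth_at (f x) g -> smooth_at x (g \o f).
Proof.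
move=> sf [W [oW Wfx hW]]; have [U [oU Ux hU]] := sf.
have : \forall y \near x, W (f y).
  exact: (smooth_at_continuous sf) (open_nbhs_nbhs (conj oW Wfx)).
move=> /near_open[U' [oU' U'x fU']].
have oI := openI oU oU'.
exists (U `&` U'); split=> // k.
apply: (@Ck_comp _ _ _ _ _ _ _ _ W) => // [y [_ /fU']//|].
by apply: Ck_sub (hU k) => ? [].
Qed.

End SmoothAt.

(** * Inverses of smooth homeomorphisms *)

Section InverseDiff.
Context {R : realType}.

(** Put h = G (k + F x) - x. Applying [B] to the expansion of [F] at [x] with increment h shows that
    h - B k is the image of a remainder o(h). Hence h = O(k), and the remainder is o(k). *)
Lemma inverse_diff (E1 E2 : normedModType R) (F : E1 -> E2) (G : E2 -> E1)
    (x : E1) (B : {linear E2 -> E1}) : continuous B ->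
  differentiable F x -> {for F x, continuous G} -> G (F x) = x ->
  (\forall y \near F x, F (G y) = y) ->
  cancel ('d F x) B ->
  differentiable G (F x) /\ 'd G (F x) = B :> (E2 -> E1).
Proof.
move=> Bc dF cG GF FG dK.
have [C C0 BC] := linear_lipschitz Bc.
have GB : G \o shift (F x) = cst (G (F x)) + B +o_ 0 id.
  apply/eqaddoP => _/posnumP[e].
  (* The bound 2^-1 / C gives |h - B k| <= |h| / 2, hence |h| <= 2 C |k|; the bound e / (2 C^2) then
     gives |h - B k| <= e |k|. *)
  pose e1 := Num.min (2^-1 / C) (e%:num / (2 * C ^+ 2)).
  have e10 : 0 < e1.
    by rewrite lt_min; apply/andP; split;
      rewrite divr_gt0 ?mulr_gt0 ?exprn_gt0 ?invr_gt0.
  have := diff_locally dF => /eqaddoP /(_ e1 e10) Fx.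
  have FG0 : \forall k \near 0, F (G (k + F x)) = k + F x.
    have := FG; rewrite (near_shift 0 (F x)) /= => FG'.
    by apply: filterS FG' => h /=; rewrite subr0.
  have cG0 : (fun k => G (k + F x) - x) k @[k --> 0] --> (0 : E1).
    have -> : (0 : E1) = G (0 + F x) - x by rewrite add0r GF subrr.
    apply: cvgB; last exact: cvg_cst.
    have sh : (k + F x) @[k --> (0 : E2)] --> 0 + F x.
      by apply: cvgD; [exact: cvg_id|exact: cvg_cst].
    by move: sh; rewrite add0r => sh; exact: cvg_comp sh cG.
  have := cG0 _ Fx => /= {}Fx.
  near=> k.
  have FGk : F (G (k + F x)) = k + F x by near: k.
  have : `|(F \o shift x - (cst (F x) + 'd F x)) (G (k + F x) - x)|
      <= e1 * `|id (G (k + F x) - x)| by near: k.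
  rewrite !fctE /= subrK FGk GF.
  set h := G _ - x => hle.
  have hB : h - B k = - B (k + F x - (F x + 'd F x h)).
    by rewrite addrKA linearB dK opprB.
  have -> : G (k + F x) - (x + B k) = h - B k by rewrite opprD addrA.
  have hBle : `|h - B k| <= C * (e1 * `|h|).
    by rewrite hB normrN (le_trans (BC _))// ler_wpM2l// ltW.
  have h2 : `|h| <= 2 * C * `|k|.
    have : `|h| <= `|h - B k| + `|B k|.
      by rewrite -[X in `|X| <= _](subrK (B k)) ler_normD.
    move=> /le_trans/(_ (lerD hBle (BC k))).
    have e1C : C * (e1 * `|h|) <= 2^-1 * `|h|.
      rewrite mulrA ler_wpM2r// -ler_pdivlMl// mulrC.
      by rewrite /e1 ge_min lexx.
    move=> /le_trans/(_ (lerD e1C (lexx _))).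
    rewrite -lerBlDl -{1}[`|h|]mul1r -mulrBl (_ : 1 - 2^-1 = 2^-1 :> R); last first.
      by rewrite {1}(splitr 1) mul1r addrK.
    by rewrite ler_pdivrMl// mulrA.
  apply: le_trans hBle _.
  apply: (@le_trans _ _ (C * (e1 * (2 * C * `|k|)))).
    by apply: ler_wpM2l (ltW C0) _ _ _; exact: ler_wpM2l (ltW e10) _ _ _.
  rewrite !mulrA ler_wpM2r//.
  have : e1 <= e%:num / (2 * C ^+ 2) by rewrite /e1 ge_min lexx orbT.
  rewrite ler_pdivlMr ?mulr_gt0 ?exprn_gt0//.
  rewrite (_ : e1 * (2 * C ^+ 2) = C * e1 * 2 * C)//.
  by rewrite expr2 [C * e1]mulrC !mulrA; congr (_ * _); rewrite -!mulrA [2 * C]mulrC.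
have dE := diff_unique Bc GB.
split; last exact: dE.
by apply/diff_locallyP; rewrite dE; split; [exact: Bc|exact: GB].
Unshelve. all: by end_near. Qed.

End InverseDiff.

Section Inverse.
Context {R : realType} {p q : nat}.
Notation E := 'M[R]_(p, q).
Implicit Types F G : E -> E.

Lemma smooth_at_derive (E1 E2 : normedModType R) (U : set E1) (f : E1 -> E2) v x :
  open U -> smooth_on U f -> U x -> smooth_at x ('D_v f).
Proof.
move=> oU hf Ux; exists U; split=> // k.
by have [_] := hf k.+1; apply.
Qed.

(** The Jacobian matrix in the row convention: it multiplies [mxvec v] from the right. The inverse
    differential thus becomes an [invmx], which depends smoothly on [x]. *)
Definition jac F (x : E) : 'M[R]_(p * q) :=
  \matrix_(a, b) mxvec ('D_(vec_mx (delta_mx 0 a)) F x) 0 b.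

Lemma mxvec_jac F x v : differentiable F x ->
  mxvec v *m jac F x = mxvec ('d F x v).
Proof.
move=> dF; rewrite -(mul_vec_lin ('d F x)); congr (_ *m _).
by apply/matrixP => a b; rewrite !mxE /= deriveE.
Qed.

(** Preimages of the coordinate vectors are the rows of a left inverse, and the matrix is square. *)
Lemma jac_unit F x : differentiable F x ->
  (forall w, exists v, 'd F x v = w) -> jac F x \in unitmx.
Proof.
move=> dF sF; rewrite -row_full_unit; apply/row_fullP.
have h (b : 'I_(p * q)) : exists u : 'rV_(p * q), u *m jac F x = delta_mx 0 b.
  have [v hv] := sF (vec_mx (delta_mx 0 b)).
  by exists (mxvec v); rewrite mxvec_jac// hv vec_mxK.
exists (\matrix_b sval (cid (h b))); apply/row_matrixP => b.
by rewrite row_mul rowK (svalP (cid (h b))) row1.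
Qed.

(** Openness of [F] makes [G] continuous, hence differentiable by [inverse_diff]. On the image
    ['D_v G] is [D v \o G], where [D v x] is the inverse differential of [F] at [x] applied to [v];
    regularity of [G] therefore climbs one order at a time. *)
Lemma inverse_smooth (U : set E) F G : open U -> smooth_on U F ->
  (forall x w, U x -> exists v, 'd F x v = w) ->
  (forall x, U x -> G (F x) = x) ->
  (forall O, open O -> O `<=` U -> open (F @` O)) ->
  smooth_on (F @` U) G.
Proof.
move=> oU sF dF GF oF.
pose D v x := vec_mx (mxvec v *m invmx (jac F x)) : E.
have dFx x : U x -> differentiable F x by have [+ _] := sF 1%N; apply.
have Ju x : U x -> jac F x \in unitmx.
  by move=> Ux; apply: jac_unit => [|w]; [exact: dFx|exact: dF].
have sD v : smooth_on U (D v).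
  apply/(smooth_onP _ oU) => x Ux.
  have sJ : smooth_at x (jac F).
    apply: smooth_at_mx => a b; under eq_fun do rewrite mxE.
    apply: smooth_at_entry.
    apply: (@smooth_at_lin _ _ _ _ _ _ (mxvec : {linear E -> _})).
      exact: mx_linear_continuous.
    exact: smooth_at_derive Ux.
  apply: (@smooth_at_lin _ _ _ _ _ _ (vec_mx : {linear _ -> E})).
    exact: mx_linear_continuous.
  apply: smooth_at_mul; first exact: smooth_at_cst.
  by apply: smooth_at_invmx => //; exact: Ju.
have oW : open (F @` U) by exact: oF.
have cG x : U x -> {for F x, continuous G}.
  move=> Ux N; rewrite GF// => Nx.
  have [W [oW' Wx WN]] := near_open Nx.
  have oFW : open (F @` (U `&` W)) by apply: oF; [exact: openI|move=> ? []].
  have : nbhs (F x) (F @` (U `&` W)).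
    by apply: open_nbhs_nbhs; split=> //; exists x.
  by apply: filterS => _ [y [Uy Oy] <-] /=; rewrite GF//; exact: WN.
have dG x : U x -> differentiable G (F x) /\ forall v, 'd G (F x) v = D v x.
  move=> Ux.
  have lin : linear (D^~ x).
    by move=> a v w; rewrite /D !linearP mulmxDl -scalemxAl linearP.
  pose B : {linear E -> E} := HB.pack (D^~ x) (GRing.isLinear.Build _ _ _ _ _ lin).
  have Bc : continuous B by exact: mx_linear_continuous.
  have [|||dGx dGE] := inverse_diff Bc (dFx x Ux) (cG x Ux).
  - exact: GF.
  - apply: filterS (open_nbhs_nbhs (conj oW _)); last by exists x.
    by move=> _ [y Uy <-]; rewrite GF.
  - move=> v; rewrite /B /= /D -mxvec_jac ?mulmxK ?mxvecK//; first exact: Ju.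
    exact: dFx.
  - by split=> // v; rewrite dGE.
elim=> [|k IH] /=; first by move=> _ [x Ux <-]; exact: cG.
split=> [_ [x Ux <-]|v]; first by have [] := dG x Ux.
apply: (@Ck_eq _ _ _ _ _ (D v \o G)) => //.
  move=> y; rewrite inE => -[x Ux <-]; have [dGx dGE] := dG x Ux.
  by rewrite (deriveE _ dGx) dGE /= GF.
by apply: (Ck_comp oW oU _ IH (sD v k)) => _ [x Ux <-]; rewrite GF.
Qed.

End Inverse.

(** Balls with rational centres and radii 1 / (k + 1); this serves the second countability of
    [Phi]. *)
Lemma mx_countable_base (R : realType) p q : exists B : set (set 'M[R]_(p, q)),
  [/\ countable B, B `<=` open & forall O x, open O -> O x ->
     exists2 U, B U & U x /\ U `<=` O].
Proof.
pose ctr (M : 'M[rat]_(p, q)) : 'M[R]_(p, q) := \matrix_(i, j) ratr (M i j).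
pose b (M : 'M[rat]_(p, q) * nat) : set 'M[R]_(p, q) := ball (ctr M.1) (M.2.+1%:R^-1).
exists (range b); split.
- exact: card_le_trans (card_image_le _ _) (countableP _).
- by move=> _ [M _ <-]; exact: ball_open.
move=> O x oO Ox.
have /nbhs_ballP[e /= e0 eO] := open_nbhs_nbhs (conj oO Ox).
have e2 : 0 < e / 2 by rewrite divr_gt0.
(* As d < e / 2, a ball of radius d that contains [x] lies in the ball of radius e about [x]. *)
have [k] := ltr_add_invr e2; rewrite add0r; set d := _^-1 => dk.
have d0 : 0 < d by rewrite invr_gt0.
have h (ij : 'I_p * 'I_q) : exists r : rat, ball (x ij.1 ij.2) d (ratr r).
  have : x ij.1 ij.2 - d < x ij.1 ij.2 + d by rewrite ltrBlDr -addrA ltrDl addr_gt0.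
  move=> /rat_in_itvoo[r]; rewrite in_itv/= => /andP[r1 r2]; exists r.
  by rewrite /ball /= ltr_distlC r1 r2.
have [f fE] := choice h.
have xb : ball (ctr (\matrix_(i, j) f (i, j))) d x.
  by apply: ball_sym; split=> // i j; rewrite !mxE; exact: (fE (i, j)).
exists (b (\matrix_(i, j) f (i, j), k)); first by exists (\matrix_(i, j) f (i, j), k).
split=> [|y yb]; first exact: xb.
apply: eO; rewrite (splitr e).
apply: ball_triangle (le_ball (ltW dk) (ball_sym xb)) _.
exact: (le_ball (ltW dk) yb).
Qed.

(** * Fractional linear maps *)

Section FractionalLinear.
Context {R : realType} {n : nat}.
Implicit Types (x : 'rV[R]_n) (w : 'rV[R]_n.+1) (M N : 'M[R]_n.+1).

Definition dehom w : 'rV[R]_n := \row_i (w ord0 (lift ord0 i) / w ord0 ord0).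

Definition hom x : 'rV[R]_n.+1 := \row_i oapp (x ord0) 1 (unlift ord0 i).

(** The projective transformation of matrix [M] in affine coordinates; the value is 0 where the
    denominator vanishes. *)
Definition flmap M x : 'rV[R]_n := dehom (hom x *m M).

Definition e0 : 'rV[R]_n.+1 := hom 0.

Lemma hom0 x : hom x ord0 ord0 = 1.
Proof. by rewrite mxE unlift_none. Qed.

Lemma homS x i : hom x ord0 (lift ord0 i) = x ord0 i.
Proof. by rewrite mxE liftK. Qed.

Lemma e0E : e0 = delta_mx 0 0.
Proof.
apply/rowP => i; rewrite !mxE /=; case: unliftP => [j|] -> //=.
by rewrite mxE.
Qed.

Lemma rowS_eq w w' : w ord0 ord0 = w' ord0 ord0 ->
  (forall i, w ord0 (lift ord0 i) = w' ord0 (lift ord0 i)) -> w = w'.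
Proof.
move=> h0 hS; apply/rowP => i; rewrite -[0]/ord0.
by case: (unliftP ord0 i) => [j|] ->.
Qed.

Lemma hom_neq0 x : hom x != 0.
Proof.
by apply/eqP => /(congr1 (fun w => w ord0 ord0)) /eqP; rewrite hom0 mxE oner_eq0.
Qed.

Lemma homK : cancel hom dehom.
Proof. by move=> x; apply/rowP => i; rewrite mxE homS hom0 divr1. Qed.

Lemma dehomK w : w ord0 ord0 != 0 -> hom (dehom w) = (w ord0 ord0)^-1 *: w.
Proof.
move=> w0; apply: rowS_eq => [|i]; first by rewrite hom0 mxE mulVf.
by rewrite homS !mxE mulrC.
Qed.

Lemma dehomZ (k : R) w : k != 0 -> dehom (k *: w) = dehom w.
Proof. by move=> k0; apply/rowP => i; rewrite !mxE -mulf_div divff ?mul1r. Qed.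

Lemma smooth_dehom w : w ord0 ord0 != 0 -> smooth_at w dehom.
Proof.
move=> w0; apply: smooth_at_mx => i j; rewrite [i]ord1.
under eq_fun do rewrite mxE.
have sI k : smooth_at w (fun v : 'rV_n.+1 => v ord0 k).
  by apply: smooth_at_entry; exact: smooth_at_id.
by apply: smooth_atM (sI _) _; exact: smooth_atV (sI _).
Qed.

Lemma smooth_hom x : smooth_at x hom.
Proof.
apply: smooth_at_mx => i j; rewrite [i]ord1.
under eq_fun do rewrite mxE.
case: (unlift _ _) => [k|] /=; last exact: smooth_at_cst.
by apply: smooth_at_entry; exact: smooth_at_id.
Qed.

Lemma smooth_flmap M x : (hom x *m M) ord0 ord0 != 0 -> smooth_at x (flmap M).
Proof.
move=> h; apply: (smooth_at_comp (f := fun x => hom x *m M)).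
  by apply: smooth_at_mul; [exact: smooth_hom|exact: smooth_at_cst].
exact: smooth_dehom.
Qed.

Lemma near_flmap M x : (hom x *m M) ord0 ord0 != 0 ->
  \forall y \near x, (hom y *m M) ord0 ord0 != 0.
Proof.
move=> h; have s : smooth_at x (fun y => (hom y *m M) ord0 ord0).
  apply: smooth_at_entry; apply: smooth_at_mul; last exact: smooth_at_cst.
  exact: smooth_hom.
exact: (smooth_at_continuous s) (open_nbhs_nbhs (conj (@open_neq R 0) h)).
Qed.

(** Dehomogenizing halfway only rescales the row vector, and [dehom] ignores nonzero factors. *)
Lemma flmap_comp M N x : (hom x *m M) ord0 ord0 != 0 ->
  flmap N (flmap M x) = flmap (M *m N) x.
Proof.
by move=> h; rewrite /flmap dehomK// -scalemxAl dehomZ ?invr_eq0// mulmxA.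
Qed.

Lemma flmap1 x : flmap 1%:M x = x.
Proof. by rewrite /flmap mulmx1 homK. Qed.

Definition normal_mx (t : 'cV[R]_n) (W : 'M[R]_n) : 'M[R]_n.+1 :=
  block_mx (1%:M : 'M[R]_1) 0 t W.

Lemma row_mx_ord0 (a : 'M[R]_1) x : (row_mx a x : 'rV_n.+1) ord0 ord0 = a ord0 ord0.
Proof. by rewrite -(row_mxEl a x) /=; congr (row_mx _ _ _ _); exact/val_inj. Qed.

Lemma row_mx_lift (a : 'M[R]_1) x i :
  (row_mx a x : 'rV_n.+1) ord0 (lift ord0 i) = x ord0 i.
Proof. by rewrite -(row_mxEr a x) /=; congr (row_mx _ _ _ _); exact/val_inj. Qed.

Lemma hom_row_mx x : hom x = row_mx (1%:M : 'M[R]_1) x.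
Proof.
apply: rowS_eq => [|i]; first by rewrite hom0 row_mx_ord0 mxE eqxx.
by rewrite homS row_mx_lift.
Qed.

Lemma hom_normal_mx x t W :
  hom x *m normal_mx t W = row_mx (1 + x *m t) (x *m W).
Proof.
rewrite hom_row_mx.
apply: etrans (mul_row_block (1%:M : 'M[R]_1) x 1%:M 0 t W) _.
by rewrite mul1mx mulmx0 add0r.
Qed.

Lemma e0_normal_mx t W : e0 *m normal_mx t W = e0.
Proof. by rewrite /e0 hom_normal_mx !mul0mx addr0 hom_row_mx. Qed.

Lemma unitmx_normal_mx t W : (normal_mx t W \in unitmx) = (W \in unitmx).
Proof.
have := @det_lblock R 1 n 1%:M t W.
by rewrite det1 mul1r !unitmxE => <-.
Qed.

Lemma e0_invmx_normal t W : W \in unitmx ->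
  e0 *m invmx (normal_mx t W) = e0.
Proof.
rewrite -(unitmx_normal_mx t) => Nu.
by have := mulmxK Nu e0; rewrite e0_normal_mx.
Qed.

Lemma flmap_normal t W x :
  flmap (normal_mx t W) x = (1 + (x *m t) ord0 ord0)^-1 *: (x *m W).
Proof.
apply/rowP => i.
by rewrite /flmap hom_normal_mx mxE row_mx_lift row_mx_ord0 !mxE eqxx mulrC.
Qed.

(** In [flmap_normal] the factor x W is linear and vanishes at 0, where the other factor is 1; the
    product rule leaves w W. This is where [t] disappears. *)
Lemma diff_flmap_normal t (W : 'M[R]_n) (w : 'rV[R]_n) :
  'd (flmap (normal_mx t W)) (0 : 'rV[R]_n) w = w *m W.
Proof.
have sf : smooth_at (0 : 'rV[R]_n) (flmap (normal_mx t W)).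
  apply: smooth_flmap.
  by rewrite hom_normal_mx row_mx_ord0 mul0mx addr0 mxE eqxx oner_eq0.
have df := smooth_at_differentiable sf.
rewrite -(deriveE _ df) derive_mx; last exact: diff_derivable.
pose k (x : 'rV[R]_n) : R := (1 + (x *m t) ord0 ord0)^-1.
apply/matrixP => i j; rewrite mxE.
pose l (x : 'rV[R]_n) : R := (x *m W) i j.
rewrite (_ : (fun x => flmap _ x i j) = k * l); last first.
  by apply/funext => x; rewrite flmap_normal mxE.
have dl : smooth_at 0 l.
  apply: smooth_at_entry; apply: smooth_at_mul; last exact: smooth_at_cst.
  exact: smooth_at_id.
have dk : smooth_at 0 k.
  apply: smooth_atV; first by rewrite mul0mx mxE addr0 oner_eq0.
  apply: smooth_atD; first exact: smooth_at_cst.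
  apply: smooth_at_entry; apply: smooth_at_mul; last exact: smooth_at_cst.
  exact: smooth_at_id.
have {}dl := smooth_at_differentiable dl.
have {}dk := smooth_at_differentiable dk.
rewrite deriveM; [|exact: diff_derivable|exact: diff_derivable].
have -> : k 0 = 1 by rewrite /k mul0mx mxE addr0 invr1.
have -> : l 0 = 0 by rewrite /l mul0mx mxE.
rewrite scale1r scale0r addr0 deriveE//.
have lin : linear (fun x : 'rV[R]_n => (x *m W) i j).
  by move=> a u v; rewrite mulmxDl -scalemxAl !mxE.
pose lL : {linear 'rV[R]_n -> R} := HB.pack (fun x : 'rV[R]_n => (x *m W) i j)
  (GRing.isLinear.Build _ _ _ _ _ lin).
have lc : continuous lL by exact: (@mx_linear_continuous R _ _ R lL).
exact: (congr1 (fun f => f w) (diff_lin 0 lc)).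
Qed.

End FractionalLinear.

Lemma unitmx_mul0 (F : fieldType) m (M : 'M[F]_m) (u : 'rV[F]_m) :
  M \in unitmx -> u *m M = 0 -> u = 0.
Proof. by move=> Mu /(congr1 (mulmx^~ (invmx M))); rewrite mulmxK// mul0mx. Qed.

Lemma unitmx_rowP (F : fieldType) m (M : 'M[F]_m) :
  (forall u : 'rV[F]_m, u *m M = 0 -> u = 0) -> M \in unitmx.
Proof.
move=> h; rewrite -row_free_unit -kermx_eq0; apply/eqP.
by apply/row_matrixP => i; rewrite row0; apply: h; rewrite -row_mul mulmx_ker row0.
Qed.

(** * Projective frames *)

Section Frames.
Context {R : realType} {n : nat} {V : vectType R}.
Variables (vec : {linear 'rV[R]_n.+1 -> V}) (crd : {linear V -> 'rV[R]_n.+1}).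
Hypotheses (vecK : cancel vec crd) (crdK : cancel crd vec).
Hypothesis (hV : \dim (fullv : {vspace V}) = n.+1).
Implicit Types (u : 'rV[R]_n.+1) (B M : 'M[R]_n.+1).
Implicit Types (c d : chart (set V) 'rV[R]_n) (g h : set V -> set V) (r : frame n V).

Lemma ptZ (v : V) k : k != 0 -> pt (k *: v) = pt v.
Proof.
move=> k0; apply/seteqP; split => [_ [c c0 ->]|_ [c c0 ->]].
  by exists (c * k); [rewrite mulf_neq0|rewrite scalerA].
by exists (c / k); [rewrite mulf_neq0 ?invr_eq0|rewrite scalerA divfK].
Qed.

Lemma pt_self (v : V) : pt v v.
Proof. by exists 1; rewrite ?oner_eq0 ?scale1r. Qed.

Lemma pt_inj (v w : V) : pt v = pt w -> exists2 k, k != 0 & v = k *: w.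
Proof. by move=> h; have := pt_self v; rewrite h. Qed.

Lemma vec_neq0 u : (vec u == 0) = (u == 0).
Proof.
apply/eqP/eqP => [h|->]; last exact: linear0.
by rewrite -(vecK u) h linear0.
Qed.

Lemma pt_vec_inj u u' : pt (vec u) = pt (vec u') -> exists2 k, k != 0 & u = k *: u'.
Proof.
move=> /pt_inj[k k0]; rewrite -linearZ => h; exists k => //.
by rewrite -(vecK u) h vecK.
Qed.

Lemma Pn_vecP (M : set V) : Pn M <-> exists2 u, u != 0 & M = pt (vec u).
Proof.
split=> [[v v0 ->]|[u u0 ->]]; last by exists (vec u); rewrite ?vec_neq0.
by exists (crd v); rewrite ?crdK// -vec_neq0 crdK.
Qed.

(* Coordinates of the points of a frame in a generating basis. *)
Definition sel (i : 'I_n.+2) : 'rV[R]_n.+1 :=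
  oapp (fun j => delta_mx 0 j) (const_mx 1) (unlift ord_max i).

Definition mxframe B : frame n V := fun i => pt (vec (sel i *m B)).

Lemma sel_lift j : sel (lift ord_max j) = delta_mx 0 j.
Proof. by rewrite /sel liftK. Qed.

Lemma sel_max : sel ord_max = const_mx 1.
Proof. by rewrite /sel unlift_none. Qed.

Lemma sel_ord0 : sel ord0 = e0.
Proof.
rewrite e0E (_ : ord0 = lift ord_max ord0 :> 'I_n.+2) ?sel_lift//.
exact/val_inj.
Qed.

Lemma sel_neq0 i : sel i != 0.
Proof.
case: (unliftP ord_max i) => [j|] ->; rewrite ?sel_lift ?sel_max; apply/eqP.
  by move=> /(congr1 (fun w : 'rV_ _ => w 0 j)) /eqP; rewrite !mxE !eqxx oner_eq0.
by move=> /(congr1 (fun w : 'rV_ _ => w 0 0)) /eqP; rewrite !mxE oner_eq0.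
Qed.

Lemma widen_lift (j : 'I_n.+1) : widen_ord (leqnSn n.+1) j = lift ord_max j.
Proof. by apply/val_inj/esym; exact: lift_max. Qed.

Lemma sum_vec_row (c : 'I_n.+1 -> R) B :
  \sum_i c i *: vec (row i B) = vec ((\row_i c i) *m B).
Proof.
rewrite mulmx_sum_row linear_sum; apply: eq_bigr => i _.
by rewrite mxE linearZ.
Qed.

Definition mxbasis B : n.+1.-tuple V := [tuple vec (row i B) | i < n.+1].

Lemma mxbasis_basis B : B \in unitmx -> basis_of fullv (mxbasis B).
Proof.
move=> Bu; rewrite basisEfree subvf hV size_tuple leqnn !andbT.
apply/freeP => k; rewrite (eq_bigr (fun i => k i *: vec (row i B))); last first.
  by move=> i _; rewrite -tnth_nth tnth_mktuple.
rewrite sum_vec_row => /eqP; rewrite vec_neq0 => /eqP/(unitmx_mul0 Bu) h i.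
by have := congr1 (fun w : 'rV_ _ => w 0 i) h; rewrite !mxE.
Qed.

Lemma mxframe_generates B : B \in unitmx -> generates (mxbasis B) (mxframe B).
Proof.
move=> Bu; split=> [|i|]; first exact: mxbasis_basis.
  by rewrite tnth_mktuple widen_lift /mxframe sel_lift -rowE.
rewrite /mxframe sel_max; congr (pt _).
transitivity (\sum_i (1 : R) *: vec (row i B)).
  by apply: eq_bigr => i _; rewrite tnth_mktuple scale1r.
by rewrite sum_vec_row; congr (vec (_ *m _)); apply/rowP => i; rewrite !mxE.
Qed.

(* The unit point forces the scaling factors of the basis vectors to agree. *)
Lemma generates_mxframe B b : B \in unitmx -> generates b (mxframe B) ->
  exists2 k, k != 0 & forall i, tnth b i = k *: vec (row i B).
Proof.
move=> Bu [_ hb hs].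
have {}hb i : exists a : R, tnth b i = a *: vec (row i B).
  have := hb i; rewrite widen_lift /mxframe sel_lift -rowE => /pt_inj[c _ ->].
  by exists c.
have [c cE] := choice hb.
move: hs; rewrite (eq_bigr (fun i => c i *: vec (row i B))); last by [].
rewrite sum_vec_row /mxframe => /pt_vec_inj[k k0].
rewrite sel_max scalemxAl => /eqP; rewrite -subr_eq0 -mulmxBl.
move=> /eqP/(unitmx_mul0 Bu)/eqP; rewrite subr_eq0 => /eqP h.
exists k => // i; rewrite cE; congr (_ *: _).
by have := congr1 (fun w : 'rV_ _ => w 0 i) h; rewrite !mxE mulr1.
Qed.

(** The basis and the representative chosen inside [hcoord] differ from the rows of [B] and from [u]
    by nonzero factors; [k] is the quotient of these factors. *)
Lemma hcoord_mxframe B u : B \in unitmx -> u != 0 ->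
  exists2 k, k != 0 &
    forall i, hcoord (mxframe B) (pt (vec u)) i = k * (u *m invmx B) ord0 i.
Proof.
move=> Bu u0; rewrite /hcoord.
set b := xget _ _; set v := xget 0 _.
have gb : generates b (mxframe B).
  by apply: (@xgetPex _ _ [set b | generates b (mxframe B)]);
    exists (mxbasis B); exact: mxframe_generates.
have [k k0 vE] : pt (vec u) v.
  by apply: (@xgetPex _ _ (pt (vec u))); exists (vec u); exact: pt_self.
have [c c0 bE] := generates_mxframe Bu gb.
exists (k / c); first by rewrite mulf_neq0// invr_eq0.
move=> i; have -> : v = \sum_j (k / c * (u *m invmx B) ord0 j) *: b`_j.
  rewrite vE -{1}(mulmxKV Bu u) mulmx_sum_row linear_sum scaler_sumr.
  apply: eq_bigr => j _; rewrite -tnth_nth bE linearZ !scalerA; congr (_ *: _).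
  by rewrite [RHS]mulrAC divfK.
have [/andP[_ fb] _ _] := gb; by rewrite coord_sum_free.
Qed.

Lemma affine_mxframe B u : B \in unitmx -> u != 0 ->
  affine_chart (mxframe B) (pt (vec u)) = dehom (u *m invmx B).
Proof.
move=> Bu u0; have [k k0 hk] := hcoord_mxframe Bu u0.
by apply/rowP => i; rewrite [LHS]mxE [RHS]mxE !hk -mulf_div divff ?mul1r.
Qed.

Lemma cdom_affine B u : B \in unitmx -> u != 0 ->
  cdom (affine_chart (mxframe B)) (pt (vec u)) <-> (u *m invmx B) ord0 ord0 != 0.
Proof.
move=> Bu u0; have [k k0 hk] := hcoord_mxframe Bu u0.
rewrite /= hk mulf_eq0 negb_or k0 /=; split=> [[]//|h]; split=> //.
by apply/Pn_vecP; exists u.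
Qed.

Lemma cdom_affineP B P : B \in unitmx ->
  cdom (affine_chart (mxframe B)) P <-> exists x, P = pt (vec (hom x *m B)).
Proof.
move=> Bu; split=> [[/Pn_vecP[u u0 ->] h]|[x ->]].
  have {}h : cdom (affine_chart (mxframe B)) (pt (vec u)).
    by split=> //; apply/Pn_vecP; exists u.
  have {}h := (cdom_affine Bu u0).1 h.
  exists (dehom (u *m invmx B)).
  rewrite dehomK// -scalemxAl mulmxKV// linearZ ptZ// invr_eq0//.
apply/cdom_affine => //; last by rewrite mulmxK// hom0 oner_eq0.
by apply/eqP => /(unitmx_mul0 Bu)/eqP; rewrite (negPf (hom_neq0 _)).
Qed.

Lemma hom_mul_neq0 B x : B \in unitmx -> hom x *m B != 0.
Proof.
by move=> Bu; apply/eqP => /(unitmx_mul0 Bu)/eqP; rewrite (negPf (hom_neq0 _)).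
Qed.

Lemma affine_hom B x : B \in unitmx ->
  affine_chart (mxframe B) (pt (vec (hom x *m B))) = x.
Proof. by move=> Bu; rewrite affine_mxframe ?hom_mul_neq0// mulmxK// homK. Qed.

Lemma cinv_affine B x : B \in unitmx ->
  cinv (affine_chart (mxframe B)) x = pt (vec (hom x *m B)).
Proof.
move=> Bu; rewrite /cinv; set P := (X in get X).
have [] : P (get P).
  apply: getPex; exists (pt (vec (hom x *m B))); split; last exact: affine_hom.
  by apply/cdom_affineP => //; exists x.
by move=> /(cdom_affineP _ Bu)[y ->]; rewrite affine_hom// => ->.
Qed.

(** A linear relation between the columns of the minor is a nonzero linear form vanishing on all
    points but [r j]. By rank and nullity its kernel has dimension n, against general position. *)
Lemma pframe_minor (r : frame n V) (u : 'I_n.+2 -> 'rV[R]_n.+1) :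
  projective_frame r -> (forall i, r i = pt (vec (u i))) ->
  forall j, \matrix_i u (lift j i) \in unitmx.
Proof.
move=> [_ gr] ru j; apply/negPn/negP; set N := \matrix_i _ => NN.
apply: (gr j).
have : kermx N^T != 0 by rewrite kermx_eq0 row_free_unit unitmx_tr.
move=> /rowV0Pn[k /sub_kermxP kN k0].
have Nk i : u (lift j i) *m k^T = 0.
  have := congr1 trmx kN; rewrite trmx_mul trmxK trmx0.
  by move=> /(congr1 (row i)); rewrite row_mul rowK row0.
pose f (v : V) : R^o := (crd v *m k^T) 0 0.
have flin : linear f by move=> a v w; rewrite /f linearP mulmxDl -scalemxAl !mxE.
pose fL : {linear V -> R^o} := HB.pack f (GRing.isLinear.Build _ _ _ _ _ flin).
exists (lker (linfun fL)).
  have := limg_ker_dim (linfun fL) fullv; rewrite capfv hV.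
  suff -> : \dim (limg (linfun fL)) = 1%N by rewrite addn1 => -[].
  apply/eqP; rewrite eqn_leq; apply/andP; split.
    by apply: (leq_trans (dimvS (subvf _))); rewrite dimvf.
  rewrite lt0n dimv_eq0; apply/eqP => h.
  move: k0; apply/negP/negPn/eqP/rowP => i; rewrite mxE.
  have : linfun fL (vec (delta_mx 0 i)) \in limg (linfun fL) by rewrite memv_img ?memvf.
  by rewrite h memv0 lfunE /= /f vecK -rowE !mxE => /eqP.
move=> i; case: (unliftP j i) => [l|] ->; last by rewrite eqxx.
move=> _ v; rewrite ru => -[c c0 ->] /=.
rewrite memv_ker; apply/eqP; apply: etrans (lfunE fL _) _.
by rewrite -[LHS]/(f _) /f -linearZ vecK -scalemxAl Nk !mxE mulr0.
Qed.

(** Any n + 1 of the basis vectors and their sum span the space: an omitted basis vector is the sum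
    minus the others. *)
Lemma mxframe_pframe B : B \in unitmx -> projective_frame (mxframe B).
Proof.
move=> Bu; split=> [i|j [W dW hW]].
  apply/Pn_vecP; exists (sel i *m B) => //.
  by apply/eqP => /(unitmx_mul0 Bu)/eqP; rewrite (negPf (sel_neq0 i)).
have inW i : i != j -> vec (sel i *m B) \in W.
  by move=> /hW; apply; exact: pt_self.
have rowW k : vec (row k B) \in W.
  have [kj|kj] := eqVneq (lift ord_max k) j; last first.
    by have := inW _ kj; rewrite sel_lift -rowE.
  have := inW ord_max; rewrite -kj neq_lift => /(_ isT).
  rewrite sel_max mulmx_sum_row linear_sum (bigD1 k)//= mxE scale1r.
  set S := (X in _ + X) => h; rewrite -(addrK S (vec (row k B))).
  rewrite rpredB// rpred_sum// => i ik; rewrite linearZ memvZ//.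
  by have := inW (lift ord_max i); rewrite -kj (inj_eq lift_inj) => /(_ ik);
     rewrite sel_lift -rowE.
have : (fullv <= W)%VS.
  have /andP[/eqP <- _] := mxbasis_basis Bu.
  by apply/span_subvP => _ /tnthP[i ->]; rewrite tnth_mktuple.
by move=> /dimvS; rewrite dW hV ltnn.
Qed.

(** The representative of the unit point is a combination of those of the other points, with
    coefficients [l] that general position makes nonzero. Rescaling the representatives by [l] gives
    a generating basis. *)
Lemma pframeP (r : frame n V) :
  projective_frame r -> exists2 B, B \in unitmx & r = mxframe B.
Proof.
move=> pr; have [rP _] := pr.
have {}rP i : exists u, r i = pt (vec u) by have /Pn_vecP[u _ ->] := rP i; exists u.
have [u ru] := choice rP.
pose M := \matrix_i u (lift ord_max i).
have Mu : M \in unitmx by exact: pframe_minor pr ru ord_max.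
pose l := u ord_max *m invmx M.
pose z i : R := oapp (l 0) (-1) (unlift ord_max i).
have zu : \sum_i z i *: u i = 0.
  rewrite (bigD1_ord ord_max)//= {1}/z unlift_none /= scaleN1r.
  rewrite (eq_bigr (fun i => l 0 i *: row i M)) => [|i _]; last first.
    by rewrite /z liftK rowK.
  by rewrite -mulmx_sum_row mulmxKV// addNr.
(* If [l 0 i] vanished, [z] would be a relation between the points other than that of index [i],
   nontrivial because of its coefficient -1 at the unit point. *)
have l0 i : l 0 i != 0.
  apply/eqP => li0.
  have zj : z (lift ord_max i) = 0 by rewrite /z liftK.
  have Nu := pframe_minor pr ru (lift ord_max i).
  have := zu; rewrite (bigD1_ord (lift ord_max i))//= zj scale0r add0r => zN.
  have : (\row_k z (lift (lift ord_max i) k)) = 0.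
    apply: (unitmx_mul0 Nu); rewrite mulmx_sum_row -[RHS]zN.
    by apply: eq_bigr => k _; rewrite mxE rowK.
  case: (unliftP (lift ord_max i) ord_max) => [k kE|/eqP].
    move=> /(congr1 (fun w : 'rV_ _ => w 0 k)) /eqP.
    by rewrite !mxE -kE /z unlift_none /= oppr_eq0 oner_eq0.
  by rewrite (negPf (neq_lift _ _)).
exists (diag_mx l *m M).
  rewrite unitmx_mul Mu andbT unitmxE det_diag unitfE.
  by apply/prodf_neq0 => i _; exact: l0.
apply/funext => i; rewrite ru /mxframe mulmxA.
case: (unliftP ord_max i) => [j|] ->.
  by rewrite sel_lift -rowE row_diag_mx -scalemxAl -rowE rowK linearZ ptZ.
have -> : sel ord_max *m diag_mx l = l.
  by rewrite sel_max mul_mx_diag; apply/rowP => k; rewrite !mxE mul1r.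
by rewrite mulmxKV.
Qed.

Lemma mxframeZ k B : k != 0 -> mxframe (k *: B) = mxframe B.
Proof.
by move=> k0; apply/funext => i; rewrite /mxframe -scalemxAr linearZ ptZ.
Qed.

Lemma mxframe_ord0 B : mxframe B ord0 = pt (vec (e0 *m B)).
Proof. by rewrite /mxframe sel_ord0. Qed.

Notation A := (pt (vec e0)).

Lemma FP_normal t W : W \in unitmx -> FP A (mxframe (normal_mx t W)).
Proof.
move=> Wu; split; first by apply: mxframe_pframe; rewrite unitmx_normal_mx.
by rewrite mxframe_ord0 e0_normal_mx.
Qed.

(** A frame starting at A has a matrix whose first row is k times [e0]; dividing the matrix by k
    leaves the frame unchanged. *)
Lemma FPP (r : frame n V) : FP A r ->
  exists t W, W \in unitmx /\ r = mxframe (normal_mx t W).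
Proof.
move=> [/pframeP[B Bu ->]]; rewrite mxframe_ord0 => /pt_vec_inj[k k0 Bk].
pose B' : 'M[R]_(1 + n) := k^-1 *: B.
have B'E : B' = normal_mx (dlsubmx B') (drsubmx B').
  have h : usubmx B' = row_mx 1%:M 0.
    rewrite -hom_row_mx -/e0; apply/row_matrixP => i; rewrite [i]ord1 [RHS]row_id.
    rewrite -[LHS]/(row _ _) /B'.
    apply/rowP => j; rewrite e0E !mxE.
    have := congr1 (fun w : 'rV_ _ => w 0 j) Bk.
    rewrite /= e0E -rowE !mxE => h.
    rewrite (_ : lshift n (0 : 'I_1) = 0 :> 'I_n.+1) ?h; last exact/val_inj.
    by rewrite mulrA mulVf// mul1r.
  rewrite /normal_mx -[LHS]vsubmxK h block_mxEv; congr col_mx.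
  by rewrite hsubmxK.
have B'u : B' \in unitmx by rewrite unitmxZ// unitfE invr_eq0.
exists (dlsubmx B'), (drsubmx B'); rewrite -B'E mxframeZ ?invr_eq0//; split=> //.
by rewrite -(unitmx_normal_mx (dlsubmx B')) -B'E.
Qed.

(** * Affine charts and tangent vectors *)

Definition mxchart B : chart (set V) 'rV[R]_n := affine_chart (mxframe B).

Notation chartA := (charts_at (@Pn_charts R n V) A).

Lemma Pn_chartsP c : Pn_charts c -> exists2 B, B \in unitmx & c = mxchart B.
Proof. by move=> [r /pframeP[B Bu ->] <-]; exists B. Qed.

Lemma mxchart_Pn B : B \in unitmx -> Pn_charts (mxchart B).
Proof. by move=> Bu; exists (mxframe B) => //; exact: mxframe_pframe. Qed.

(** A relation, since [M] is determined by [g] at most up to a nonzero factor. *)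
Definition induces (g : set V -> set V) M :=
  M \in unitmx /\ forall u, u != 0 -> g (pt (vec u)) = pt (vec (u *m M)).

Lemma induces_id : induces id 1%:M.
Proof. by split=> [|u _]; rewrite ?unitmx1// mulmx1. Qed.

Lemma proj_induces g : proj_transformation g -> exists M, induces g M.
Proof.
move=> [L Lk Lg]; exists (lin1_mx (crd \o L \o vec)); split=> [|u u0].
  apply: unitmx_rowP => u; rewrite mul_rV_lin1 /= => h; apply/eqP.
  rewrite -vec_neq0; apply/eqP/(lker0P Lk).
  by rewrite linear0 -(crdK (L _)) h linear0.
by rewrite Lg ?vec_neq0// mul_rV_lin1 /= crdK.
Qed.

(** Points are sets of vectors, so the transformation can be taken to be the direct image by a
    linear operator. *)
Lemma induces_proj M : M \in unitmx ->
  exists2 g, proj_transformation g & induces g M.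
Proof.
move=> Mu; pose L := linfun (vec \o mulmxr M \o crd).
have LE v : L v = vec (crd v *m M) by rewrite lfunE.
have gL v : [set L w | w in pt v] = pt (L v).
  apply/seteqP; split => [_ [_ [c c0 ->] <-]|_ [c c0 ->]].
    by exists c => //; rewrite linearZ.
  by exists (c *: v); [exists c|rewrite linearZ].
exists (fun P => [set L w | w in P]).
  exists L => [|v _]; last exact: gL.
  apply/lker0P => v w; rewrite !LE => /(can_inj vecK)/(can_inj (mulmxK Mu)).
  exact: can_inj.
by split=> // u u0; rewrite gL LE vecK.
Qed.

(** An equality of total functions: every row vector is the coordinate vector of some point of the
    first chart, and outside the domain of the second chart both sides have the default value of
    [dehom]. *)
Lemma loc_mxchart g M B B' : B \in unitmx -> B' \in unitmx -> induces g M ->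
  loc (mxchart B) (mxchart B') g = flmap (B *m M *m invmx B').
Proof.
move=> Bu Bu' [Mu gM]; apply/funext => x.
rewrite -[LHS]/(affine_chart (mxframe B') (g (cinv (affine_chart (mxframe B)) x))).
rewrite cinv_affine// gM ?hom_mul_neq0//.
have -> : hom x *m B *m M = hom x *m (B *m M) by rewrite mulmxA.
rewrite affine_mxframe ?hom_mul_neq0 ?unitmx_mul ?Bu//.
by rewrite /flmap !mulmxA.
Qed.

Lemma chartA_lead B : B \in unitmx -> chartA (mxchart B) ->
  (e0 *m invmx B) ord0 ord0 != 0.
Proof. by move=> Bu [_ /(cdom_affine Bu (hom_neq0 0))]. Qed.

Lemma mxchartA B : B \in unitmx -> mxchart B A = dehom (e0 *m invmx B).
Proof. by move=> Bu; exact: affine_mxframe Bu (hom_neq0 0). Qed.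

Lemma hom_mxchartA B M : B \in unitmx -> chartA (mxchart B) ->
  hom (mxchart B A) *m (B *m M) =
  ((e0 *m invmx B) ord0 ord0)^-1 *: (e0 *m M).
Proof.
move=> Bu cB; rewrite mxchartA// dehomK ?chartA_lead//.
by rewrite -scalemxAl mulmxA mulmxKV.
Qed.

(** As [g] fixes [A], [e0 *m M] is proportional to [e0]. Up to nonzero factors, the denominator is
    thus the leading coordinate of [A] in the basis [B']. *)
Lemma loc_lead g M B B' : B \in unitmx -> B' \in unitmx -> induces g M ->
  g A = A -> chartA (mxchart B) -> chartA (mxchart B') ->
  (hom (mxchart B A) *m (B *m M *m invmx B')) ord0 ord0 != 0.
Proof.
move=> Bu Bu' [Mu gM] gA cB cB'.
rewrite -mulmxA hom_mxchartA// mxE mulf_neq0 ?invr_eq0 ?chartA_lead//.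
have := gM e0 (hom_neq0 0); rewrite gA => /pt_vec_inj[k k0 h].
have := chartA_lead Bu' cB'.
by rewrite {1}h -scalemxAl mxE mulf_eq0 negb_or mulmxA => /andP[].
Qed.

Lemma smooth_loc g c d : proj_transformation g -> g A = A ->
  chartA c -> chartA d -> smooth_at (c A) (loc c d g).
Proof.
move=> /proj_induces[M gM] gA cA dA.
have [/Pn_chartsP[B Bu cE] _] := cA; have [/Pn_chartsP[B' Bu' dE] _] := dA.
subst c d; rewrite (loc_mxchart Bu Bu' gM); apply: smooth_flmap.
exact: (loc_lead Bu Bu' gM).
Qed.

Lemma locA (g : set V -> set V) (c d : chart (set V) 'rV[R]_n) :
  chartA c -> loc c d g (c A) = d (g A).
Proof.
move=> cA; have [/Pn_chartsP[B Bu cE] cdA] := cA; subst c.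
rewrite -[LHS]/(d (g (cinv (mxchart B) (mxchart B A)))); congr (d (g _)).
have := (cdom_affineP _ Bu).1 cdA => -[x Ax].
by rewrite {1}Ax /mxchart affine_hom// cinv_affine.
Qed.

Lemma loc_comp g h c c' d : proj_transformation g -> g A = A ->
  proj_transformation h -> chartA c -> chartA c' -> Pn_charts d ->
  \forall y \near c A, (loc c' d h \o loc c c' g) y = loc c d (h \o g) y.
Proof.
move=> /proj_induces[M gM] gA /proj_induces[N hN] cA cA' /Pn_chartsP[B2 Bu2 ->].
have [/Pn_chartsP[B Bu cE] _] := cA; have [/Pn_chartsP[B' Bu' dE] _] := cA'.
subst c c'.
have hgN : induces (h \o g) (M *m N).
  have [[Mu gMu] [Nu hNu]] := (gM, hN); split; first by rewrite unitmx_mul Mu.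
  move=> u u0; rewrite /= gMu// hNu ?mulmxA//.
  by apply/eqP => /(unitmx_mul0 Mu)/eqP; rewrite (negPf u0).
rewrite (loc_mxchart Bu Bu' gM) (loc_mxchart Bu' Bu2 hN) (loc_mxchart Bu Bu2 hgN).
apply: filterS (near_flmap (loc_lead Bu Bu' gM gA cA cA')) => y hy.
by rewrite /= flmap_comp//; congr (flmap _ _); rewrite !mulmxA mulmxKV.
Qed.

Lemma proj_id : proj_transformation (@id (set V)).
Proof.
exists \1%VF; first by apply/lker0P => v w; rewrite !lfunE.
by move=> v _; rewrite lfunE.
Qed.

(** The differential of [g] at [A] read in the charts [c] and [d]. For [g = id] it is the change of
    coordinates of tangent vectors, so that one functoriality lemma handles both tangent vectors and
    [dA]. *)
Definition tmap g c d : 'rV[R]_n -> 'rV[R]_n := 'd (loc c d g) (c A).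

Lemma tmap_linear g c d m (w : 'I_m -> 'rV[R]_n) (a : 'I_m -> R) :
  tmap g c d (\sum_i a i *: w i) = \sum_i a i *: tmap g c d (w i).
Proof.
by rewrite /tmap linear_sum; apply: eq_bigr => i _; rewrite linearZ.
Qed.

(** The composite is a variable [k] so that [id] and [g] can themselves be given as composites with
    [id]. *)
Lemma tmap_comp g h k c c' d : k = h \o g ->
  proj_transformation g -> g A = A ->
  proj_transformation h -> h A = A -> chartA c -> chartA c' -> chartA d ->
  forall w, tmap k c d w = tmap h c' d (tmap g c c' w).
Proof.
move=> -> pg gA ph hA cA cA' dA w; rewrite /tmap.
have sg := smooth_at_differentiable (smooth_loc pg gA cA cA').
have sh := smooth_at_differentiable (smooth_loc ph hA cA' dA).
have gcA : loc c c' g (c A) = c' A by rewrite locA// gA.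
rewrite -gcA in sh.
have ne := loc_comp pg gA ph cA cA' (proj1 dA).
have [_ E] := @near_eq_diff R _ _ (loc c' d h \o loc c c' g) (loc c d (h \o g))
   (c A) ne (differentiable_comp sg sh).
apply: etrans (congr1 (fun f => f w) E) _.
apply: etrans (congr1 (fun f => f w) (diff_comp sg sh)) _.
by rewrite -gcA.
Qed.

Lemma tmap_id c w : chartA c -> tmap id c c w = w.
Proof.
move=> [/Pn_chartsP[B Bu ->] _]; rewrite /tmap.
rewrite (loc_mxchart Bu Bu induces_id) mulmx1 mulmxV//.
rewrite (_ : flmap 1%:M = id); last by apply/funext => x; exact: flmap1.
by rewrite (@diff_val _ _ _ _ _ _ _ (is_diff_id _)).
Qed.

Notation TAn := (@TA R n V A).
Notation tv := (tangent_of (@Pn_charts R n V) A).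

Lemma tvE c d w : chartA d -> tv c w d = tmap id c d w.
Proof. by move=> dA; rewrite /tangent_of asboolT. Qed.

Lemma tv_out c d w : ~ chartA d -> tv c w d = 0.
Proof. by move=> dA; rewrite /tangent_of asboolF. Qed.

Lemma TA_trans xi c d : TAn xi -> chartA c -> chartA d ->
  xi d = tmap id c d (xi c).
Proof. by move=> [h _]; exact: h. Qed.

Lemma tv_TA c w : chartA c -> TAn (tv c w).
Proof.
move=> cA; split=> [d d' dA dA'|d]; last exact: tv_out.
rewrite !tvE//.
exact: (tmap_comp (erefl id) proj_id (erefl A) proj_id (erefl A) cA dA dA').
Qed.

Lemma tv_id c w : chartA c -> tv c w c = w.
Proof. by move=> cA; rewrite tvE// tmap_id. Qed.

Lemma TA_tv xi c : TAn xi -> chartA c -> xi = tv c (xi c).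
Proof.
move=> xiA cA; apply/funext => d; have [dA|dA] := pselect (chartA d).
  by rewrite tvE//; exact: TA_trans.
by rewrite tv_out//; have [_] := xiA; apply.
Qed.

Definition std_chart := mxchart 1%:M.

Lemma chart_normal t W : W \in unitmx -> chartA (mxchart (normal_mx t W)).
Proof.
move=> Wu; have Nu : normal_mx t W \in unitmx by rewrite unitmx_normal_mx.
split; first exact: mxchart_Pn.
apply/cdom_affine => //; first exact: hom_neq0.
by rewrite e0_invmx_normal// hom0 oner_eq0.
Qed.

Lemma normal_mx1 : normal_mx 0 1%:M = 1%:M :> 'M[R]_n.+1.
Proof. by rewrite /normal_mx -[RHS]/(1%:M : 'M[R]_(1 + n)) -scalar_mx_block. Qed.

Lemma std_chartA : chartA std_chart.
Proof. by rewrite /std_chart -normal_mx1; exact: chart_normal (unitmx1 _ _). Qed.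

Lemma mxchart_normalA t W : W \in unitmx -> mxchart (normal_mx t W) A = 0.
Proof.
move=> Wu; have Nu : normal_mx t W \in unitmx by rewrite unitmx_normal_mx.
by rewrite mxchartA// e0_invmx_normal// homK.
Qed.

(** * Bases of the tangent space as invertible matrices *)

Definition emx (e : 'I_n -> tangentA n V) : 'M[R]_n := \matrix_i e i std_chart.

Lemma tangent_sumE (x : 'rV[R]_n) (e : 'I_n -> tangentA n V) d :
  (\sum_(i < n) x ord0 i *: e i) d = \sum_(i < n) x ord0 i *: e i d.
Proof. by rewrite fct_sumE. Qed.

Lemma comb_std_chart (x : 'rV[R]_n) (e : 'I_n -> tangentA n V) :
  (\sum_(i < n) x ord0 i *: e i) std_chart = x *m emx e.
Proof.
by rewrite tangent_sumE mulmx_sum_row; apply: eq_bigr => i _; rewrite rowK.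
Qed.

Lemma comb_TA (x : 'rV[R]_n) (e : 'I_n -> tangentA n V) :
  (forall i, TAn (e i)) -> TAn (\sum_(i < n) x ord0 i *: e i).
Proof.
move=> eA; split=> [c d cA dA|c cA]; rewrite !tangent_sumE.
  rewrite -[RHS]/(tmap id c d _) tmap_linear; apply: eq_bigr => i _; congr (_ *: _).
  exact: TA_trans.
by apply: big1 => i _; have [_ ->] := eA i; rewrite ?scaler0.
Qed.

Lemma TA_eq xi xi' : TAn xi -> TAn xi' -> xi std_chart = xi' std_chart -> xi = xi'.
Proof.
move=> hx hx' h; rewrite (TA_tv hx std_chartA) h -TA_tv//.
exact: std_chartA.
Qed.

Lemma TA_comb xi (e : 'I_n -> tangentA n V) : (forall i, TAn (e i)) ->
  emx e \in unitmx -> TAn xi ->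
  xi = \sum_(i < n) (xi std_chart *m invmx (emx e)) ord0 i *: e i.
Proof.
move=> eA eu xiA; apply: (TA_eq xiA (comb_TA _ eA)).
by rewrite comb_std_chart mulmxKV.
Qed.

(** Uniqueness of the coordinates of 0 makes the rows of [emx e] independent. Conversely,
    multiplication by [invmx (emx e)] computes coordinates. *)
Lemma FVP e : FV n A e <-> (forall i, TAn (e i)) /\ emx e \in unitmx.
Proof.
split=> [[eA eB]|[eA eu]]; split=> //.
  apply: unitmx_rowP => x xe.
  have z0 : (0 : tangentA n V) = \sum_(i < n) (0 : 'rV[R]_n) ord0 i *: e i.
    by rewrite big1// => i _; rewrite mxE scale0r.
  have TA0 : TAn 0 by rewrite z0; exact: comb_TA.
  have [y [_ yP]] := eB _ TA0.
  have <- : y = x; first apply: yP.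
    by apply: TA_eq => //; [exact: comb_TA|rewrite comb_std_chart xe].
  exact: yP.
move=> xi xiA; exists (xi std_chart *m invmx (emx e)); split; first exact: TA_comb.
by move=> y ->; rewrite comb_std_chart mulmxK.
Qed.

Lemma coordsE e xi : FV n A e -> TAn xi -> coords e xi = xi std_chart *m invmx (emx e).
Proof.
move=> /FVP[eA eu] xiA; rewrite /coords; set P := (X in get X).
have : P (get P).
  by apply: getPex; exists (xi std_chart *m invmx (emx e)); exact: TA_comb.
by move=> {1}->; rewrite comb_std_chart mulmxK.
Qed.

Lemma FV_chartE e f : FV n A e -> FV n A f ->
  FV_chart A e f = emx f *m invmx (emx e).
Proof.
move=> eF /FVP[fA _]; apply/row_matrixP => i.
by rewrite row_mul !rowK coordsE.
Qed.

Definition basis_of_mx (W : 'M[R]_n) : 'I_n -> tangentA n V :=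
  fun i => tv std_chart (row i W).

Lemma emxK W : emx (basis_of_mx W) = W.
Proof.
apply/row_matrixP => i; rewrite rowK /basis_of_mx tv_id//.
exact: std_chartA.
Qed.

Lemma basis_of_mx_FV W : W \in unitmx -> FV n A (basis_of_mx W).
Proof.
by move=> Wu; apply/FVP; rewrite emxK; split=> // i; apply: tv_TA; exact: std_chartA.
Qed.

Lemma basis_of_mxK e : FV n A e -> basis_of_mx (emx e) = e.
Proof.
move=> /FVP[eA _]; apply/funext => i.
by rewrite /basis_of_mx rowK -TA_tv//; exact: std_chartA.
Qed.

(** * The group action on frames and the [H]-orbits *)

Lemma mxframe_act g M B : B \in unitmx -> induces g M ->
  frame_act g (mxframe B) = mxframe (B *m M).
Proof.
move=> Bu [Mu gM]; apply/funext => i; rewrite /frame_act /mxframe gM ?mulmxA//.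
by apply/eqP => /(unitmx_mul0 Bu)/eqP; rewrite (negPf (sel_neq0 i)).
Qed.

(** The transition from the chart of the frame to [std_chart] is [flmap (normal_mx t W)],
    differentiated at 0, the coordinates of A. *)
Lemma emx_eps t W : W \in unitmx ->
  emx (eps A (mxframe (normal_mx t W))) = W.
Proof.
move=> Wu; apply/row_matrixP => i; rewrite rowK /eps.
have Nu : normal_mx t W \in unitmx by rewrite unitmx_normal_mx.
rewrite tvE; last exact: std_chartA.
rewrite /tmap -/(mxchart _) (loc_mxchart Nu (unitmx1 _ _) induces_id).
by rewrite invmx1 !mulmx1 mxchart_normalA// diff_flmap_normal -rowE.
Qed.

Lemma eps_TA r i : FP A r -> TAn (eps A r i).
Proof.
by move=> /FPP[t [W [Wu ->]]]; apply: tv_TA; exact: chart_normal.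
Qed.

Lemma eps_FV r : FP A r -> FV n A (eps A r).
Proof.
move=> rF; apply/FVP; split=> [i|]; first exact: eps_TA.
by move: rF => /FPP[t [W [Wu ->]]]; rewrite emx_eps.
Qed.

(** Functoriality replaces the source chart picked by [get] with an arbitrary chart [c] at A. *)
Lemma dAE g xi c : proj_transformation g -> g A = A -> TAn xi -> chartA c ->
  dA n A g xi = fun d => if `[< chartA d >] then tmap g c d (xi c) else 0.
Proof.
move=> pg gA xiA cA; apply/funext => d; rewrite /dA /tangent_map gA.
set c1 := get _; have c1A : chartA c1 by apply: getPex; exists c.
case: asboolP => // dA.
rewrite (TA_trans xiA cA c1A) -/(tmap g c1 d _); apply/esym.
exact: (tmap_comp (erefl g) proj_id (erefl A) pg gA cA c1A dA).
Qed.

Lemma FP_act g r : G A g -> FP A r -> FP A (frame_act g r).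
Proof.
move=> [/proj_induces[M gM] gA] [/pframeP[B Bu ->] r0]; split.
  rewrite (mxframe_act Bu gM); apply: mxframe_pframe.
  by have [Mu _] := gM; rewrite unitmx_mul Bu.
by rewrite /frame_act r0.
Qed.

(** The coordinates of g(M) with respect to the frame g r are those of M with respect to r. Hence
    the identity read from the chart of g r has the same local expression as [g] read from the chart
    of r, and A has coordinates 0 in both. *)
Lemma eps_act g r : G A g -> FP A r ->
  eps A (frame_act g r) = fun i => dA n A g (eps A r i).
Proof.
move=> gG rF; have [pg gA] := gG; have grF := FP_act gG rF.
have [t [W [Wu rE]]] := FPP rF; have [t' [W' [Wu' grE]]] := FPP grF.
have cA := chart_normal t Wu; have cA' := chart_normal t' Wu'.
have Nu : normal_mx t W \in unitmx by rewrite unitmx_normal_mx.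
have Nu' : normal_mx t' W' \in unitmx by rewrite unitmx_normal_mx.
have [M gM] := proj_induces pg; have [Mu _] := gM.
apply/funext => i; rewrite (dAE pg gA (eps_TA i rF) cA).
have -> : eps A r i = tv (mxchart (normal_mx t W)) (delta_mx ord0 i) by rewrite rE.
have -> : eps A (frame_act g r) i = tv (mxchart (normal_mx t' W')) (delta_mx ord0 i).
  by rewrite grE.
rewrite (tv_id _ cA); apply/funext => d.
have [dA|dA] := pselect (chartA d); last first.
  by rewrite (tv_out _ _ dA) (asboolF dA).
rewrite (asboolT dA) (tvE _ _ dA) /tmap (mxchart_normalA _ Wu) (mxchart_normalA _ Wu').
have [/Pn_chartsP[B Bu dE] _] := dA; subst d.
suff -> : loc (mxchart (normal_mx t' W')) (mxchart B) id =
  loc (mxchart (normal_mx t W)) (mxchart B) g by [].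
have NMu : normal_mx t W *m M \in unitmx by rewrite unitmx_mul Nu.
have -> : mxchart (normal_mx t' W') = mxchart (normal_mx t W *m M).
  by rewrite /mxchart -grE rE (mxframe_act Nu gM).
by rewrite (loc_mxchart Nu Bu gM) (loc_mxchart NMu Bu induces_id) mulmx1.
Qed.

(** One inclusion is equivariance. For the other, the transformation carrying the normal generating
    basis of [r] to that of [r'] fixes [A], and its differential fixes every vector of the basis
    [eps A r]; so it belongs to [H]. *)
Lemma HorbitE r : FP A r ->
  Horbit A r = [set r' : frame n V | FP A r' /\ eps A r' = eps A r].
Proof.
move=> rF; apply/seteqP; split=> [_ [h [hG hH] <-]|r' [rF' erE]].
  split; first exact: FP_act.
  by rewrite eps_act//; apply/funext => i; rewrite hH//; exact: eps_TA.
have [t [W [Wu rE]]] := FPP rF; have [t' [W' [Wu' rE']]] := FPP rF'.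
have Nu : normal_mx t W \in unitmx by rewrite unitmx_normal_mx.
have Nu' : normal_mx t' W' \in unitmx by rewrite unitmx_normal_mx.
have Mu : invmx (normal_mx t W) *m normal_mx t' W' \in unitmx.
  by rewrite unitmx_mul unitmx_inv Nu.
have [g pg gM] := induces_proj Mu.
have gA : g A = A.
  have [_ ->] := gM; last exact: hom_neq0.
  by rewrite mulmxA (e0_invmx_normal _ Wu) e0_normal_mx.
have gr : frame_act g r = r' by rewrite rE (mxframe_act Nu gM) mulKVmx.
have gG : G A g := conj pg gA.
exists g; last exact: gr.
split=> [|xi xiA]; first exact: gG.
have /FVP[eA eu] := eps_FV rF.
have xiE := TA_comb eA eu xiA.
have ge i : dA n A g (eps A r i) = eps A r i.
  by have := congr1 (fun e => e i) (eps_act gG rF); rewrite gr erE.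
rewrite (dAE pg gA xiA std_chartA); apply/funext => d.
have [dA|dA] := pselect (chartA d); last first.
  by rewrite (asboolF dA); have [_ ->] := xiA.
rewrite (asboolT dA).
rewrite xiE !tangent_sumE tmap_linear; apply: eq_bigr => i _; congr (_ *: _).
by have := congr1 (fun f => f d) (ge i); rewrite (dAE pg gA (eA i) std_chartA) asboolT.
Qed.

(** * Charts of the space of frames *)

(** Completes a nonzero vector to a basis in which it comes first. This puts a given point at the
    origin of an affine chart, and [A] at [e0]. *)
Lemma exists_unit_row u : u != 0 -> exists2 B, B \in unitmx & e0 *m B = u.
Proof.
move=> u0; pose f : 'M[R]_n.+1 := \matrix_i u.
have fE : e0 *m f = u by rewrite e0E -rowE rowK.
have [|B Bu BE] := @complete_unitmx R 1 n.+1 e0 f.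
  by rewrite fE !rank_rV u0 hom_neq0.
by exists B => //; rewrite -BE.
Qed.

Section FrameChart.
Variable Q : 'I_n.+1 -> 'M[R]_n.+1.
Hypothesis Qu : forall j, Q j \in unitmx.
Implicit Types (Y : 'M[R]_(n.+1, n)) (j : 'I_n.+1).

Definition fchart := FP_chart A (fun j => mxframe (Q j)).

(** Row j represents the point of index j + 1, in the coordinates given by [crd]. *)
Definition repr_mx Y : 'M[R]_n.+1 := \matrix_j (hom (row j Y) *m Q j).

(* [e0 + \sum_j scal_j v_j = 0] is the linear relation between representatives
   [e0, v_0, ..., v_n] of [A, A_1, ..., A_n, E]: its coefficients rescale the
   [v_j] into the generating basis with first vector [e0]. *)
Definition scal Y : 'rV[R]_n.+1 := - (e0 *m invmx (repr_mx Y)).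

(** General position of A, A_1, ..., A_n, E: the determinant of [repr_mx Y] is the minor omitting A,
    and the minor omitting the point of index j + 1 is, up to sign, [scal Y 0 j] times it. *)
Definition fdom : set 'M[R]_(n.+1, n) :=
  [set Y | repr_mx Y \in unitmx /\ forall j, scal Y 0 j != 0].

Definition scaled_row Y (i : 'I_n) : 'rV[R]_n.+1 :=
  scal Y 0 (lift ord_max i) *: row (lift ord_max i) (repr_mx Y).

Definition tpart Y : 'cV[R]_n := \col_i scaled_row Y i ord0 ord0.

Definition wpart Y : 'M[R]_n := \matrix_(i, k) scaled_row Y i ord0 (lift ord0 k).

Definition fnormal Y := normal_mx (tpart Y) (wpart Y).

Lemma row_normal0 (t : 'cV[R]_n) (W : 'M[R]_n) : row ord0 (normal_mx t W) = e0.
Proof. by rewrite rowE -[RHS](e0_normal_mx t W) e0E. Qed.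

Lemma row_normalS (t : 'cV[R]_n) (W : 'M[R]_n) (w : 'rV[R]_n.+1) i :
  w ord0 ord0 = t i 0 ->
  (forall k, w ord0 (lift ord0 k) = W i k) -> row (lift ord0 i) (normal_mx t W) = w.
Proof.
move=> w0 wS.
have e : row (rshift 1 i) (block_mx 1%:M 0 t W) = row_mx (row i t) (row i W).
  by rewrite /block_mx rowKd row_row_mx.
have -> : row (lift ord0 i) (normal_mx t W) = row (rshift 1 i) (block_mx 1%:M 0 t W).
  by congr row; exact/val_inj.
rewrite e; apply: rowS_eq => [|k]; first by rewrite row_mx_ord0 w0 mxE.
by rewrite row_mx_lift wS mxE.
Qed.

Lemma row_fnormalS Y i : row (lift ord0 i) (fnormal Y) = scaled_row Y i.
Proof. by apply: row_normalS => [|k]; rewrite [RHS]mxE. Qed.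

Lemma scal_repr Y : repr_mx Y \in unitmx -> scal Y *m repr_mx Y = - e0.
Proof. by move=> Yu; rewrite /scal mulNmx mulmxKV. Qed.

Lemma sum_scaled_row Y : repr_mx Y \in unitmx ->
  \sum_i scaled_row Y i =
  - e0 - scal Y 0 ord_max *: row ord_max (repr_mx Y).
Proof.
move=> Yu; rewrite -(scal_repr Yu) mulmx_sum_row (bigD1_ord ord_max)//=.
by rewrite addrAC subrr add0r.
Qed.

(** By the linear relation, [e0] plus the scaled rows is [- scal Y 0 ord_max] times the
    representative of the unit point. So [fnormal Y] generates the frame with coordinates [Y]. *)
Lemma sel_fnormal Y j : repr_mx Y \in unitmx -> (forall j, scal Y 0 j != 0) ->
  exists2 k, k != 0 & sel (lift ord0 j) *m fnormal Y = k *: row j (repr_mx Y).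
Proof.
move=> Yu Y0; case: (unliftP ord_max j) => [i|] ->.
  exists (scal Y 0 (lift ord_max i)) => //.
  rewrite -[RHS]/(scaled_row Y i) -row_fnormalS rowE; congr (_ *m _).
  rewrite (_ : lift ord0 _ = lift ord_max (lift ord0 i)) ?sel_lift//.
  by apply/val_inj; rewrite /= /bump !leq0n !add1n /= ltnS addnS.
exists (- scal Y 0 ord_max); first by rewrite oppr_eq0.
rewrite (_ : lift ord0 _ = ord_max); last exact/val_inj.
rewrite sel_max mulmx_sum_row (bigD1_ord ord0)//= mxE scale1r row_normal0.
under eq_bigr do rewrite mxE scale1r row_fnormalS.
by rewrite sum_scaled_row// addrA addrN add0r scaleNr.
Qed.

Lemma wpart_unit Y : fdom Y -> wpart Y \in unitmx.
Proof.
move=> [Yu Y0]; rewrite -(unitmx_normal_mx (tpart Y)) -/(fnormal Y).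
apply: unitmx_rowP => u u0.
(* Subtracting [u 0 0] times the relation given by [scal] from [u *m fnormal Y = 0] eliminates [e0];
   the coefficients left on the rows of [repr_mx Y] form [z]. *)
pose z := \row_j ((oapp (fun i => u 0 (lift ord0 i)) 0 (unlift ord_max j) - u 0 0)
                   * scal Y 0 j).
have z0 : z = 0.
  apply: (unitmx_mul0 Yu).
  rewrite mulmx_sum_row (bigD1_ord ord_max)//= mxE unlift_none /= sub0r.
  under eq_bigr do rewrite mxE liftK /= -scalerA -/(scaled_row Y _) scalerBl.
  rewrite big_split /= -[X in _ + (_ + X)]/(\sum_i - _) sumrN -scaler_sumr.
  rewrite sum_scaled_row//.
  have : \sum_i u 0 (lift ord0 i) *: scaled_row Y i = - (u 0 0 *: e0).
    move: u0; rewrite mulmx_sum_row (bigD1_ord ord0)//= row_normal0.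
    under eq_bigr do rewrite row_fnormalS.
    by move=> /eqP; rewrite addrC addr_eq0 => /eqP.
  move=> ->; rewrite scalerBr scalerN mulNr scaleNr scalerA opprB opprK.
  by rewrite addrA -opprD addNr.
have zE j : (oapp (fun i => u 0 (lift ord0 i)) 0 (unlift ord_max j) - u 0 0) = 0.
  have := congr1 (fun w : 'rV_ _ => w 0 j) z0; rewrite [LHS]mxE [RHS]mxE => /eqP.
  by rewrite mulf_eq0 (negPf (Y0 j)) orbF => /eqP.
have u00 : u 0 0 = 0.
  apply/eqP; rewrite -oppr_eq0 -sub0r.
  by have := zE ord_max; rewrite unlift_none /= => ->.
apply: rowS_eq => [|i]; rewrite mxE; first exact: u00.
by have := zE (lift ord_max i); rewrite liftK /= u00 subr0.
Qed.

Lemma fnormal_point Y j : fdom Y ->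
  mxframe (fnormal Y) (lift ord0 j) = pt (vec (hom (row j Y) *m Q j)).
Proof.
move=> [Yu Y0]; have [k k0 h] := sel_fnormal j Yu Y0.
by rewrite /mxframe h linearZ ptZ// rowK.
Qed.

Lemma fnormal_FP Y : fdom Y -> FP A (mxframe (fnormal Y)).
Proof. by move=> /wpart_unit; exact: FP_normal. Qed.

Lemma fnormal_cdom Y : fdom Y -> cdom fchart (mxframe (fnormal Y)).
Proof.
move=> Yd; split=> [|j]; first exact: fnormal_FP.
by rewrite fnormal_point//; apply/cdom_affineP => //; exists (row j Y).
Qed.

Lemma fnormalK Y : fdom Y -> fchart (mxframe (fnormal Y)) = Y.
Proof.
move=> Yd; apply/row_matrixP => j.
rewrite rowK fnormal_point//.
exact: affine_hom.
Qed.

(** The rows of [repr_mx Y] are proportional to vectors built from the normal generating basis of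
    [r]. The proportionality factors yield a relation with coefficient 1 at [e0], which is unique as
    [repr_mx Y] is invertible; so [scal] recovers them. *)
Lemma fchartP r : cdom fchart r -> fdom (fchart r) /\ r = mxframe (fnormal (fchart r)).
Proof.
move=> [rF rQ]; set Y := fchart r.
have [t [W [Wu rE]]] := FPP rF.
have Nu : normal_mx t W \in unitmx by rewrite unitmx_normal_mx.
have rj j : r (lift ord0 j) = pt (vec (row j (repr_mx Y))).
  have /(cdom_affineP _ (Qu j))[x xE] := rQ j.
  by rewrite !rowK xE affine_hom.
have Yu : repr_mx Y \in unitmx.
  pose u i := oapp (fun j => row j (repr_mx Y)) e0 (unlift ord0 i).
  have -> : repr_mx Y = \matrix_i u (lift ord0 i).
    by apply/row_matrixP => j; rewrite [RHS]rowK /u liftK.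
  apply: (pframe_minor (proj1 rF)) => i; rewrite /u.
  by case: unliftP => [j|] ->; [exact: rj|have [] := rF].
have rk j : exists k, k != 0 /\
    sel (lift ord0 j) *m normal_mx t W = k *: row j (repr_mx Y).
  have := rj j; rewrite rE => /pt_vec_inj[k k0 h].
  by exists k.
have [k {}rk] := choice rk.
have rkS i : row (lift ord0 i) (normal_mx t W) =
    k (lift ord_max i) *: row (lift ord_max i) (repr_mx Y).
  have [_ <-] := rk (lift ord_max i).
  rewrite (_ : lift ord0 (lift ord_max i) = lift ord_max (lift ord0 i)).
    by rewrite sel_lift -rowE.
  by apply/val_inj; rewrite /= /bump !leq0n !add1n /= ltnS addnS.
(* With v_j the rows of [repr_mx Y], the unit point gives k_max v_max = e0 + \sum_(j < max) k_j v_j,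
   whence the sign at [ord_max]. *)
have scE : scal Y = \row_j (if j == ord_max then - k j else k j).
  rewrite /scal -mulNmx; apply: (canLR (mulmxK Yu)).
  rewrite mulmx_sum_row (bigD1_ord ord_max)//= mxE eqxx scaleNr.
  have [_ <-] := rk ord_max.
  rewrite (_ : lift ord0 ord_max = ord_max); last exact/val_inj.
  rewrite sel_max mulmx_sum_row (bigD1_ord ord0)//= mxE scale1r row_normal0.
  rewrite opprD -addrA -[LHS]addr0; congr (_ + _); apply/esym/eqP.
  rewrite addrC subr_eq0; apply/eqP; apply: eq_bigr => i _.
  by rewrite !mxE scale1r rkS eq_sym (negPf (neq_lift _ _)).
have sc0 j : scal Y 0 j != 0.
  by have [k0 _] := rk j; rewrite scE mxE; case: ifP; rewrite ?oppr_eq0.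
split; first by split.
rewrite rE; congr mxframe; apply/row_matrixP => i.
case: (unliftP ord0 i) => [l|] ->; last by rewrite !row_normal0.
rewrite row_fnormalS rkS /scaled_row scE mxE.
by rewrite eq_sym (negPf (neq_lift _ _)).
Qed.

Lemma fchart_image : fchart @` cdom fchart = fdom.
Proof.
apply/seteqP; split=> [_ [r rd <-]|Y Yd]; first by have [] := fchartP rd.
by exists (mxframe (fnormal Y)); [exact: fnormal_cdom|exact: fnormalK].
Qed.

Lemma cinv_fchart Y : fdom Y -> cinv fchart Y = mxframe (fnormal Y).
Proof.
move=> Yd; rewrite /cinv; set P := (X in get X).
have [rd rE] : P (get P).
  by apply: getPex; exists (mxframe (fnormal Y)); split;
    [exact: fnormal_cdom|exact: fnormalK].
by have [_ ->] := fchartP rd; rewrite rE.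
Qed.

Lemma emx_fnormal Y : fdom Y -> emx (eps A (mxframe (fnormal Y))) = wpart Y.
Proof. by move=> Yd; apply: emx_eps; exact: wpart_unit. Qed.

Lemma smooth_repr Y : smooth_at Y repr_mx.
Proof.
apply: smooth_at_mx => j k.
rewrite (_ : (fun _ => _) = fun Y => (hom (row j Y) *m Q j) 0 k); last first.
  by apply/funext => Z; rewrite mxE.
apply: smooth_at_entry; apply: smooth_at_mul; last exact: smooth_at_cst.
apply: smooth_at_mx => i l; rewrite [i]ord1.
under eq_fun do rewrite mxE.
case: (unlift _ _) => [m|] /=; last exact: smooth_at_cst.
by under eq_fun do rewrite mxE; apply: smooth_at_entry; exact: smooth_at_id.
Qed.

Lemma smooth_scal Y : repr_mx Y \in unitmx -> smooth_at Y scal.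
Proof.
move=> Yu; rewrite (_ : scal = fun Y => - e0 *m invmx (repr_mx Y)); last first.
  by apply/funext => Z; rewrite mulNmx.
apply: smooth_at_mul; first exact: smooth_at_cst.
by apply: smooth_at_invmx => //; exact: smooth_repr.
Qed.

Lemma smooth_wpart Y : fdom Y -> smooth_at Y wpart.
Proof.
move=> [Yu _]; apply: smooth_at_mx => i k.
rewrite (_ : (fun _ => _) = fun Y =>
    scal Y 0 (lift ord_max i) * repr_mx Y (lift ord_max i) (lift ord0 k)).
  apply: smooth_atM; apply: smooth_at_entry; first exact: smooth_scal.
  exact: smooth_repr.
by apply/funext => Z; rewrite [LHS]mxE [LHS]mxE; congr (_ * _); rewrite mxE.
Qed.

Lemma open_fdom : open fdom.
Proof.
rewrite openE => Y [Yu Y0] /=.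
have n1 := near_unitmx (smooth_at_continuous (smooth_repr Y)) Yu.
have n2 : \forall Z \near Y, forall j, scal Z 0 j != 0.
  apply: (@filter_forall _ _ (fun j Z => scal Z 0 j != 0) (nbhs Y)) => j.
  have s := smooth_at_continuous (smooth_at_entry 0 j (smooth_scal Yu)).
  exact: s (open_nbhs_nbhs (conj (@open_neq R 0) (Y0 j))).
by apply: filterS2 n1 n2 => Z h1 h2; split.
Qed.

Definition point_mx B j : 'rV[R]_n.+1 := sel (lift ord0 j) *m B *m invmx (Q j).

Lemma cdom_fchart r t W : W \in unitmx -> r = mxframe (normal_mx t W) ->
  cdom fchart r <-> forall j, point_mx (normal_mx t W) j ord0 ord0 != 0.
Proof.
move=> Wu ->; have Nu : normal_mx t W \in unitmx by rewrite unitmx_normal_mx.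
have N0 j : sel (lift ord0 j) *m normal_mx t W != 0.
  by apply/eqP => /(unitmx_mul0 Nu)/eqP; rewrite (negPf (sel_neq0 _)).
split=> [[_ h] j|h]; first by have := h j => /(cdom_affine (Qu j) (N0 j)).
split; first exact: FP_normal.
by move=> j; apply/(cdom_affine (Qu j) (N0 j)); exact: h.
Qed.

Lemma fchart_normal t W : W \in unitmx ->
  fchart (mxframe (normal_mx t W)) = \matrix_j dehom (point_mx (normal_mx t W) j).
Proof.
move=> Wu; have Nu : normal_mx t W \in unitmx by rewrite unitmx_normal_mx.
have N0 j : sel (lift ord0 j) *m normal_mx t W != 0.
  by apply/eqP => /(unitmx_mul0 Nu)/eqP; rewrite (negPf (sel_neq0 _)).
by apply/row_matrixP => j; rewrite !rowK; exact: affine_mxframe.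
Qed.

Lemma smooth_point_mx t j (W : 'M[R]_n) :
  smooth_at W (fun W => point_mx (normal_mx t W) j).
Proof.
apply: smooth_at_mul; last exact: smooth_at_cst.
apply: smooth_at_mul; first exact: smooth_at_cst.
apply: smooth_at_mx => i k.
case: (unliftP ord0 i) => [i'|] ->; last first.
  rewrite (_ : (fun _ => _) = fun=> e0 0 k); first exact: smooth_at_cst.
  apply/funext => Z.
  by have := congr1 (fun w : 'rV_ _ => w 0 k) (row_normal0 t Z); rewrite mxE.
rewrite (_ : (fun _ => _) = fun Z => (row_mx (row i' t) (row i' Z) : 'rV_n.+1) 0 k).
  case: (unliftP ord0 k) => [k'|] ->.
    under eq_fun do rewrite row_mx_lift mxE.
    by apply: smooth_at_entry; exact: smooth_at_id.
  under eq_fun do rewrite row_mx_ord0.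
  exact: smooth_at_cst.
apply/funext => Z; rewrite -(@row_normalS t Z (row_mx (row i' t) (row i' Z)) i').
- by rewrite [RHS]mxE.
- by rewrite row_mx_ord0 mxE.
- by move=> l; rewrite row_mx_lift mxE.
Qed.

(** For fixed [t] this is a smooth section of r |-> W, staying in the chart for nearby matrices. It
    transfers openness and smoothness from the frame space to matrices. *)
Lemma smooth_fchart_section t W : W \in unitmx ->
  cdom fchart (mxframe (normal_mx t W)) ->
  smooth_at W (fun W => fchart (mxframe (normal_mx t W))) /\
  \forall Z \near W, Z \in unitmx /\ cdom fchart (mxframe (normal_mx t Z)).
Proof.
move=> Wu /(cdom_fchart Wu erefl) h.
have nu : \forall Z \near W, Z \in unitmx.
  by apply: (@near_unitmx R _ W n id) => //; exact: cvg_id.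
split.
  apply: (smooth_at_eq (f := fun W => \matrix_j dehom (point_mx (normal_mx t W) j))).
    by apply: filterS nu => Z Zu; rewrite fchart_normal.
  apply: smooth_at_mx => j k.
  rewrite (_ : (fun _ => _) = fun Z => dehom (point_mx (normal_mx t Z) j) 0 k).
    apply: smooth_at_entry.
    apply: (@smooth_at_comp _ _ _ _ _ _ _ (fun Z => point_mx (normal_mx t Z) j)).
      exact: smooth_point_mx.
    exact/smooth_dehom/h.
  by apply/funext => Z; rewrite mxE.
have n2 : \forall Z \near W, forall j, point_mx (normal_mx t Z) j ord0 ord0 != 0.
  apply: (@filter_forall _ _
    (fun j Z => point_mx (normal_mx t Z) j ord0 ord0 != 0) (nbhs W)) => j.
  have s := smooth_at_continuous (smooth_at_entry ord0 ord0 (smooth_point_mx t j W)).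
  exact: s (open_nbhs_nbhs (conj (@open_neq R 0) (h j))).
apply: filterS2 nu n2 => Z Zu Zh; split=> //.
exact/(cdom_fchart Zu erefl).
Qed.

End FrameChart.

Lemma FP_chartsP (c : chart (frame n V) 'M[R]_(n.+1, n)) : FP_charts A c ->
  exists2 Q, (forall j, Q j \in unitmx) & c = fchart Q.
Proof.
move=> [q qp <-].
have h j : exists B, B \in unitmx /\ q j = mxframe B.
  by have [B Bu ->] := pframeP (qp j); exists B.
have [Q QE] := choice h.
exists Q => [j|]; first by have [] := QE j.
by congr FP_chart; apply/funext => j; have [] := QE j.
Qed.

Lemma fchart_FP Q : (forall j, Q j \in unitmx) -> FP_charts A (fchart Q).
Proof.
by move=> Qu; exists (fun j => mxframe (Q j)) => // j; exact: mxframe_pframe.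
Qed.

(** Each point is placed at the origin of its own affine chart: the first row of [Q j] represents
    it. *)
Lemma fchart_at r : FP A r ->
  exists2 Q, (forall j, Q j \in unitmx) & cdom (fchart Q) r.
Proof.
move=> rF; have [[rP _] _] := rF.
have h j : exists B, B \in unitmx /\ cdom (affine_chart (mxframe B)) (r (lift ord0 j)).
  have /Pn_vecP[u /exists_unit_row[B Bu <-] ->] := rP (lift ord0 j).
  by exists B; split=> //; apply/cdom_affineP => //; exists 0.
have [Q QE] := choice h.
by exists Q => [j|]; [have [] := QE j|split=> // j; have [] := QE j].
Qed.

(** * The space of orbits *)

Definition sec t W : frame n V := mxframe (normal_mx t W).

(** [orb] and [amx] are inverse bijections between GL_n and [Phi]; taking t = 0 merely selects a
    frame in the orbit. *)
Definition orb W : set (frame n V) := Horbit A (sec 0 W).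

(** Evaluated on a frame picked in the orbit; [abarE] gives the independence of this choice. *)
Definition abar (O : set (frame n V)) : 'I_n -> tangentA n V := eps A (get O).

Definition amx (O : set (frame n V)) : 'M[R]_n := emx (abar O).

Notation GLn := [set W : 'M[R]_n | W \in unitmx].

Lemma abarE r : FP A r -> abar (Horbit A r) = eps A r.
Proof.
move=> rF; rewrite /abar; have : Horbit A r (get (Horbit A r)).
  by apply: getPex; exists r; rewrite HorbitE.
by rewrite {1}(HorbitE rF) => -[_]; exact.
Qed.

Lemma eps_unit r : FP A r -> emx (eps A r) \in unitmx.
Proof. by move=> /eps_FV /FVP[]. Qed.

Lemma epsE r : FP A r -> eps A r = basis_of_mx (emx (eps A r)).
Proof. by move=> /eps_FV /basis_of_mxK ->. Qed.

Lemma orbE r : FP A r -> Horbit A r = orb (emx (eps A r)).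
Proof.
move=> rF; have ru := eps_unit rF; have sF := FP_normal 0 ru.
rewrite /orb (HorbitE rF) (HorbitE sF).
suff -> : eps A (sec 0 (emx (eps A r))) = eps A r by [].
by rewrite (epsE sF) emx_eps// basis_of_mxK//; exact: eps_FV.
Qed.

Lemma Phi_orb W : W \in unitmx -> Phi n A (orb W).
Proof. by move=> Wu; exists (sec 0 W) => //; exact: FP_normal. Qed.

Lemma PhiP O : Phi n A O -> exists2 W, W \in unitmx & O = orb W.
Proof.
by move=> [r rF <-]; exists (emx (eps A r)); [exact: eps_unit|exact: orbE].
Qed.

Lemma abar_orb W : W \in unitmx -> abar (orb W) = basis_of_mx W.
Proof.
move=> Wu; have sF := FP_normal 0 Wu.
by rewrite /orb (abarE sF) (epsE sF) emx_eps.
Qed.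

Lemma amx_orb W : W \in unitmx -> amx (orb W) = W.
Proof. by move=> Wu; rewrite /amx abar_orb// emxK. Qed.

Lemma orb_amx O : Phi n A O -> orb (amx O) = O.
Proof. by move=> /PhiP[W Wu ->]; rewrite amx_orb. Qed.

Lemma amx_unit O : Phi n A O -> amx O \in unitmx.
Proof. by move=> /PhiP[W Wu ->]; rewrite amx_orb. Qed.

Definition over (P : set 'M[R]_n) : set (frame n V) :=
  [set r | FP A r /\ P (emx (eps A r))].

Lemma over_orb (P : set 'M[R]_n) : P `<=` GLn ->
  FP A `&` Horbit A @^-1` (orb @` P) = over P.
Proof.
move=> PG; apply/seteqP; split=> [r [rF [W PW]]|r [rF Pr]].
  rewrite (orbE rF) => /(congr1 amx).
  by rewrite (amx_orb (PG _ PW)) (amx_orb (eps_unit rF)) => WE; split; rewrite -?WE.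
by split=> //; exists (emx (eps A r)) => //; rewrite -orbE.
Qed.

(** One direction pulls open sets back along the section t = 0; the other is the continuity of
    [wpart]. *)
Lemma mopen_over (P : set 'M[R]_n) : P `<=` GLn ->
  mopen (FP A) (FP_charts A) (over P) <-> open P.
Proof.
move=> PG; split=> [[_ h]|oP].
  rewrite openE => W PW; have Wu := PG W PW.
  have [Q Qu rQ] := fchart_at (FP_normal 0 Wu).
  have [sF nF] := smooth_fchart_section Qu Wu rQ.
  have oE := h _ (fchart_FP Qu).
  have Ew : (fchart Q @` (over P `&` cdom (fchart Q))) (fchart Q (sec 0 W)).
    exists (sec 0 W) => //; split=> //; split; first exact: FP_normal.
    by rewrite emx_eps.
  have nE := smooth_at_continuous sF (open_nbhs_nbhs (conj oE Ew)).
  apply: filterS2 nF nE => Z [Zu Zc] [r [[rF Pr] rc] rE].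
  have [_ rE1] := fchartP Qu rc; have [_ rE2] := fchartP Qu Zc.
  by move: Pr; rewrite rE1 rE -rE2 emx_eps.
split=> [r []//|c /FP_chartsP[Q Qu ->]].
rewrite (_ : _ @` _ = fdom Q `&` wpart Q @^-1` P).
  rewrite openE => Y [Yd PY].
  have nd := open_nbhs_nbhs (conj (open_fdom (Q := Q)) Yd).
  have nP := smooth_at_continuous (smooth_wpart Yd) (open_nbhs_nbhs (conj oP PY)).
  by apply: filterS2 nd nP => Z; split.
apply/seteqP; split=> [_ [r [[rF Pr] rc] <-]|Y [Yd PY]].
  have [Yd rE] := fchartP Qu rc; split=> //=.
  by rewrite -(emx_fnormal Yd) -rE.
exists (mxframe (fnormal Q Y)); last exact: fnormalK.
split; last exact: fnormal_cdom.
by split; [exact: fnormal_FP|rewrite emx_fnormal].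
Qed.

Lemma orb_image (O : set (set (frame n V))) : O `<=` Phi n A ->
  O = orb @` (amx @` O) /\ amx @` O `<=` GLn.
Proof.
move=> OP; split=> [|_ [ob Oo <-]]; last exact/amx_unit/OP.
apply/seteqP; split=> [ob Oo|_ [_ [ob Oo <-] <-]].
  by exists (amx ob); [exists ob|exact/orb_amx/OP].
by rewrite orb_amx//; exact: OP.
Qed.

Lemma amx_image (P : set 'M[R]_n) : P `<=` GLn -> amx @` (orb @` P) = P.
Proof.
move=> PG; apply/seteqP; split=> [_ [_ [W PW <-] <-]|W PW].
  by rewrite amx_orb//; exact: PG.
by exists (orb W); [exists W|rewrite amx_orb//; exact: PG].
Qed.

Lemma loc_Horbit Q (d : chart (set (frame n V)) 'M[R]_n) Y :
  (forall j, Q j \in unitmx) -> fdom Q Y ->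
  loc (fchart Q) d (Horbit A) Y = d (orb (wpart Q Y)).
Proof.
move=> Qu Yd; rewrite -[LHS]/(d (Horbit A (cinv (fchart Q) Y))).
rewrite cinv_fchart// orbE; last exact: fnormal_FP.
by rewrite emx_fnormal.
Qed.

(** The section through [r] with its own [t] is a local right inverse of [wpart Q]; differentiating
    it gives [v]. *)
Lemma diff_wpart_surj Q r w : (forall j, Q j \in unitmx) -> cdom (fchart Q) r ->
  exists v, 'd (wpart Q) (fchart Q r) v = w.
Proof.
move=> Qu rc; have [Yd _] := fchartP Qu rc; have [rF _] := rc.
have [t [W [Wu rE]]] := FPP rF; rewrite rE in rc Yd *.
have [sF nF] := smooth_fchart_section Qu Wu rc.
pose phi Z := fchart Q (mxframe (normal_mx t Z)).
have dphi : differentiable phi W := smooth_at_differentiable sF.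
have dw : differentiable (wpart Q) (phi W).
  exact: smooth_at_differentiable (smooth_wpart Yd).
exists ('d phi W w).
have ne : \forall Z \near W, id Z = (wpart Q \o phi) Z.
  apply: filterS nF => Z [Zu Zc]; rewrite /= /phi.
  by have [Zd ZE] := fchartP Qu Zc; rewrite -(emx_fnormal Zd) -ZE emx_eps.
have did : differentiable (@id 'M[R]_n) W := ex_diff (is_diff_def := is_diff_id W).
have [_ E] := near_eq_diff ne did.
apply: etrans (esym (congr1 (fun f => f w) (diff_comp dphi dw))) _.
apply: etrans (congr1 (fun f => f w) E) _.
exact: (congr1 (fun f => f w) (diff_val (is_diff_def := is_diff_id W))).
Qed.

(** * A quotient structure with one global chart *)

Definition amx_chart : chart (set (frame n V)) 'M[R]_n := Chart (Phi n A) amx.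

Lemma cinv_amx W : W \in unitmx -> cinv amx_chart W = orb W.
Proof.
move=> Wu; rewrite /cinv; set P := (X in get X).
have [PP <-] : P (get P).
  by apply: getPex; exists (orb W); split; [exact: Phi_orb|exact: amx_orb].
by rewrite /= orb_amx.
Qed.

Lemma mopen_amx (P : set 'M[R]_n) : P `<=` GLn ->
  mopen (Phi n A) [set amx_chart] (orb @` P) <-> open P.
Proof.
move=> PG.
have PO : orb @` P `<=` Phi n A by move=> _ [W /PG Wu <-]; exact: Phi_orb.
have PE : amx_chart @` (orb @` P `&` cdom amx_chart) = P.
  by rewrite -[RHS](amx_image PG) (setIidl PO).
split=> [[_ /(_ amx_chart erefl)]|oP]; first by rewrite PE.
by split=> // c ->; rewrite PE.
Qed.

Lemma amx_chart_image : amx_chart @` (Phi n A) = GLn.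
Proof.
apply/seteqP; split=> [_ [ob obP <-]|W Wu]; first exact: amx_unit.
by exists (orb W); [exact: Phi_orb|exact: amx_orb].
Qed.

Lemma amx_atlas : smooth_atlas (Phi n A) [set amx_chart].
Proof.
split=> [ob obP|c ->|c d -> ->]; first by exists amx_chart.
  split=> [//|O O' /set_mem OP /set_mem OP' h].
  exact: (etrans (esym (orb_amx OP)) (etrans (congr1 orb h) (orb_amx OP'))).
rewrite /= setIid amx_chart_image; split; first exact: open_unitmx.
move=> k; apply: (Ck_eq (f := id)); first exact: open_unitmx.
  by move=> W; rewrite inE => Wu; rewrite /= cinv_amx// amx_orb.
by apply: (@Ck_linear _ _ _ _ _ idfun) => x; exact: cvg_id.
Qed.

Lemma amx_hausdorff O O' : Phi n A O -> Phi n A O' -> O <> O' ->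
  exists P P' : set (set (frame n V)),
    [/\ mopen (Phi n A) [set amx_chart] P, mopen (Phi n A) [set amx_chart] P',
        P O, P' O' & P `&` P' = set0].
Proof.
move=> OP OP' OO'.
have /eqP WW' : amx O <> amx O'.
  by move=> h; apply: OO'; rewrite -(orb_amx OP) h orb_amx.
have := @norm_hausdorff R 'M[R]_n; rewrite open_hausdorff.
move=> /(_ _ _ WW')[[P P'] /= [/set_mem PO /set_mem PO'] [oP oP' PP']].
have oG := @open_unitmx R n.
exists (orb @` (P `&` GLn)), (orb @` (P' `&` GLn)); split.
- by apply/mopen_amx => [? []//|]; exact: openI.
- by apply/mopen_amx => [? []//|]; exact: openI.
- by exists (amx O); [split=> //; exact: amx_unit|exact: orb_amx].
- by exists (amx O'); [split=> //; exact: amx_unit|exact: orb_amx].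
apply/seteqP; split=> [ob|//] [[W [PW Wu] <-] [W' [PW' Wu'] /(congr1 amx)]].
rewrite (amx_orb Wu) (amx_orb Wu') => WE; rewrite WE in PW'.
have : (P `&` P') W by [].
by rewrite (eqP PP').
Qed.

(** Separation and a countable base come from the space of matrices, by intersecting with GL_n and
    transporting along [orb]. *)
Lemma amx_manifold : smooth_manifold (Phi n A) [set amx_chart].
Proof.
split; [exact: amx_atlas|exact: amx_hausdorff|].
have [B [cB oB hB]] := @mx_countable_base R n n.
exists [set orb @` (U `&` GLn) | U in B]; split.
- exact: card_le_trans (card_image_le _ _) cB.
- move=> _ [U UB <-]; apply/mopen_amx => [? []//|].
  by apply: openI; [exact: oB|exact: open_unitmx].
move=> O x mO Ox; have [OP _] := mO; have [OE OG] := orb_image OP.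
have oO : open (amx @` O) by apply/mopen_amx => //; rewrite -OE.
have [|U UB [Ux UO]] := hB _ (amx x) oO; first by exists x.
exists (orb @` (U `&` GLn)); first by exists U.
split.
  exists (amx x); last exact/orb_amx/OP.
  by split=> //; exact/amx_unit/OP.
move=> _ [W [UW Wu] <-]; have [ob Oo <-] := UO _ UW.
by rewrite orb_amx//; exact: OP.
Qed.

Lemma loc_Horbit_amx Q Y : (forall j, Q j \in unitmx) -> fdom Q Y ->
  \forall Z \near Y, wpart Q Z = loc (fchart Q) amx_chart (Horbit A) Z.
Proof.
move=> Qu Yd.
apply: filterS (open_nbhs_nbhs (conj (open_fdom (Q := Q)) Yd)) => Z Zd.
rewrite loc_Horbit// -[RHS]/(amx (orb (wpart Q Z))) amx_orb//.
exact: wpart_unit.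
Qed.

Lemma Horbit_smooth_amx :
  smooth_map (FP A) (FP_charts A) (Phi n A) [set amx_chart] (Horbit A).
Proof.
split=> [r rF|c d /FP_chartsP[Q Qu ->] ->]; first by exists r.
have -> : cdom (fchart Q) `&` Horbit A @^-1` cdom amx_chart = cdom (fchart Q).
  by apply: setIidl => r [rF _]; exists r.
rewrite /= fchart_image//; split; first exact: open_fdom.
apply/(smooth_onP _ (@open_fdom Q)) => Y Yd.
exact: smooth_at_eq (loc_Horbit_amx Qu Yd) (smooth_wpart Yd).
Qed.

(** Keeps the quantification over quotient structures from being vacuous. In this chart the
    projection is [wpart], so the submersion property is [diff_wpart_surj]. *)
Lemma quotient_structure_amx : quotient_structure A [set amx_chart].
Proof.
split; [exact: amx_manifold| | |split; first exact: Horbit_smooth_amx].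
- move=> O OP; have [OE OG] := orb_image OP.
  by rewrite OE over_orb// mopen_over//; exact: mopen_amx.
- by move=> _ [r rF <-]; exists r.
move=> r c d rF /FP_chartsP[Q Qu ->] -> rc _ w.
have [v hv] := diff_wpart_surj w Qu rc; exists v.
have [Yd _] := fchartP Qu rc.
have [_ E] := near_eq_diff (loc_Horbit_amx Qu Yd)
  (smooth_at_differentiable (smooth_wpart Yd)).
exact: (etrans (congr1 (fun f => f v) E) hv).
Qed.

(** * Arbitrary quotient structures *)

Section QuotientStructure.
Variable S : set (chart (set (frame n V)) 'M[R]_n).
Hypothesis HS : quotient_structure A S.
Implicit Types k : chart (set (frame n V)) 'M[R]_n.

(** The quotient topology at work: the frames whose orbit lies in the image of [P] form [over P].
    Thus [orb] is a homeomorphism onto [Phi] for every [S]. *)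
Lemma mopen_orb (P : set 'M[R]_n) : P `<=` GLn ->
  mopen (Phi n A) S (orb @` P) <-> open P.
Proof.
move=> PG; have [_ h _ _] := HS.
have PO : orb @` P `<=` Phi n A by move=> _ [W /PG Wu <-]; exact: Phi_orb.
by rewrite (h _ PO) over_orb// mopen_over.
Qed.

Definition orbdom k : set 'M[R]_n := GLn `&` orb @^-1` cdom k.

Lemma orb_orbdom k : S k -> orb @` orbdom k = cdom k.
Proof.
move=> Sd; have [[[_ /(_ k Sd)[dP _] _] _ _] _ _ _] := HS.
apply/seteqP; split=> [_ [W [_ dW] <-]//|ob dob].
exists (amx ob); last exact/orb_amx/dP.
by split; [exact/amx_unit/dP|rewrite /= orb_amx//; exact: dP].
Qed.

(** [cdom k] is open in [Phi], since its image in any chart is that of an overlap of two charts. *)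
Lemma open_orbdom k : S k -> open (orbdom k).
Proof.
move=> Sd; have [[[_ /(_ k Sd)[dP _] tr] _ _] _ _ _] := HS.
apply/mopen_orb; first by move=> W [].
rewrite orb_orbdom//; split=> // c Sc.
by have [] := tr c k Sc Sd; rewrite setIC.
Qed.

Lemma chart_orb_image k : S k -> (k \o orb) @` orbdom k = k @` cdom k.
Proof. by move=> Sd; rewrite -(orb_orbdom Sd) image_comp. Qed.

Lemma open_chart_orb k O : S k -> open O -> O `<=` orbdom k ->
  open ((k \o orb) @` O).
Proof.
move=> Sd oO OD.
have OG : O `<=` GLn by move=> W /OD[].
have OE : orb @` O `&` cdom k = orb @` O.
  by apply: setIidl => _ [W /OD[_ dW] <-].
by have [_ /(_ k Sd)] := (mopen_orb OG).2 oO; rewrite OE image_comp.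
Qed.

Lemma cinv_chart k O : S k -> cdom k O -> cinv k (k O) = O.
Proof.
move=> Sd dO; have [[[_ /(_ k Sd)[_ dI] _] _ _] _ _ _] := HS.
rewrite /cinv; set P := (X in get X).
have [dP dE] : P (get P) by apply: getPex; exists O.
by apply: dI => //; exact: mem_set.
Qed.

Lemma amx_cinv_orb k W : S k -> orbdom k W -> amx (cinv k ((k \o orb) W)) = W.
Proof. by move=> Sd [Wu dW]; rewrite /= cinv_chart// amx_orb. Qed.

(** Along the section t = 0 the projection read in charts becomes [k \o orb], which thereby inherits
    its smoothness. *)
Lemma chart_orb_section k W : S k -> orbdom k W ->
  exists Q, [/\ (forall j, Q j \in unitmx), cdom (fchart Q) (sec 0 W) &
    \forall Z \near W, loc (fchart Q) k (Horbit A) (fchart Q (sec 0 Z)) =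
      (k \o orb) Z].
Proof.
move=> Sd [Wu dW]; have [Q Qu rQ] := fchart_at (FP_normal 0 Wu).
exists Q; split=> //.
have [_ nF] := smooth_fchart_section Qu Wu rQ.
apply: filterS nF => Z [Zu Zc]; have [Yd ZE] := fchartP Qu Zc.
by rewrite loc_Horbit// -emx_fnormal// -ZE emx_eps.
Qed.

Lemma smooth_loc_Horbit Q k Y : (forall j, Q j \in unitmx) -> S k -> fdom Q Y ->
  cdom k (orb (wpart Q Y)) -> smooth_at Y (loc (fchart Q) k (Horbit A)).
Proof.
move=> Qu Sd Yd dY; have [_ _ _ [[_ sm] _]] := HS.
have [oU sU] := sm _ _ (fchart_FP Qu) Sd.
apply: (smooth_onP _ oU).1 sU _ _.
exists (mxframe (fnormal Q Y)); last exact: fnormalK.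
split; first exact: fnormal_cdom.
by rewrite /= orbE ?emx_fnormal//; exact: fnormal_FP.
Qed.

Lemma smooth_chart_orb k W : S k -> orbdom k W -> smooth_at W (k \o orb).
Proof.
move=> Sd dW; have [Q [Qu rQ nE]] := chart_orb_section Sd dW.
have [Wu dW'] := dW.
have [sF _] := smooth_fchart_section Qu Wu rQ.
have [Yd ZE] := fchartP Qu rQ.
apply: smooth_at_eq nE _; apply: smooth_at_comp sF _.
by apply: smooth_loc_Horbit => //; rewrite -emx_fnormal// -ZE emx_eps.
Qed.

(** In charts the projection is locally [(k \o orb) \o wpart Q]. It is a submersion, so the
    differential of the outer factor is onto as well. *)
Lemma diff_chart_orb_surj k W w : S k -> orbdom k W ->
  exists v, 'd (k \o orb) W v = w.
Proof.
move=> Sd dW; have [Q [Qu rQ _]] := chart_orb_section Sd dW.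
have [Wu dW'] := dW; have [Yd ZE] := fchartP Qu rQ.
have wE : wpart Q (fchart Q (sec 0 W)) = W by rewrite -emx_fnormal// -ZE emx_eps.
have [_ _ _ [_ sub]] := HS.
have rF := FP_normal 0 Wu.
have dr : cdom k (Horbit A (sec 0 W)) by exact: dW'.
have [v hv] := sub _ _ _ rF (fchart_FP Qu) Sd rQ dr w.
have dw := smooth_at_differentiable (smooth_wpart Yd).
pose u := 'd (wpart Q) (fchart Q (sec 0 W)) v.
exists u.
have ddo := smooth_at_differentiable (smooth_chart_orb Sd dW).
have ddo' : differentiable (k \o orb) (wpart Q (fchart Q (sec 0 W))) by rewrite wE.
have ne : \forall Z \near fchart Q (sec 0 W),
    ((k \o orb) \o wpart Q) Z = loc (fchart Q) k (Horbit A) Z.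
  apply: filterS (open_nbhs_nbhs (conj (open_fdom (Q := Q)) Yd)) => Z Zd.
  by rewrite loc_Horbit.
have [_ E] := near_eq_diff ne (differentiable_comp dw ddo').
have e1 : 'd (k \o orb) W u = 'd (k \o orb) (wpart Q (fchart Q (sec 0 W))) u.
  by rewrite wE.
have e2 := congr1 (fun f => f v) (diff_comp dw ddo').
have e3 := congr1 (fun f => f v) E.
exact: (etrans e1 (etrans (esym e2) (etrans (esym e3) hv))).
Qed.

(** [amx \o cinv k] inverts [k \o orb], to which [inverse_smooth] applies. *)
Lemma smooth_amx_cinv k : S k -> smooth_on (k @` cdom k) (amx \o cinv k).
Proof.
move=> Sd; rewrite -(chart_orb_image Sd); apply: inverse_smooth.
- exact: open_orbdom.
- by apply/(smooth_onP _ (open_orbdom Sd)) => W; exact: smooth_chart_orb.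
- by move=> W w; exact: diff_chart_orb_surj.
- by move=> W dW; exact: amx_cinv_orb.
- by move=> O oO; exact: open_chart_orb.
Qed.

Lemma abar_FV O : Phi n A O -> FV n A (abar O).
Proof. by move=> /PhiP[W Wu ->]; rewrite abar_orb//; exact: basis_of_mx_FV. Qed.

Lemma FV_chart_emx e f : FV n A e -> FV n A f -> emx f = FV_chart A e f *m emx e.
Proof.
by move=> eF fF; rewrite FV_chartE// mulmxKV//; have /FVP[] := eF.
Qed.

Lemma cinv_FV_chart e Z : FV n A e -> Z \in unitmx ->
  cinv (FV_chart A e) Z = basis_of_mx (Z *m emx e).
Proof.
move=> eF Zu; have /FVP[_ eu] := eF.
have bF : FV n A (basis_of_mx (Z *m emx e)).
  by apply: basis_of_mx_FV; rewrite unitmx_mul Zu.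
rewrite /cinv; set P := (X in get X).
have [gF gE] : P (get P).
  by apply: getPex; exists (basis_of_mx (Z *m emx e)); split=> //;
    rewrite FV_chartE// emxK mulmxK.
by rewrite -(basis_of_mxK gF) (FV_chart_emx eF gF) gE.
Qed.

(** In the chart of the basis [e], the map is [amx] followed by right multiplication by the constant
    [invmx (emx e)]. *)
Lemma abar_smooth : smooth_map (Phi n A) S (FV n A) (FV_charts n A) abar.
Proof.
split=> [ob|c k Sc [e eF <-]]; first exact: abar_FV.
have [[[_ /(_ c Sc)[cP _] tr] _ _] _ _ _] := HS.
have -> : cdom c `&` abar @^-1` cdom (FV_chart A e) = cdom c.
  by apply: setIidl => O /cP/abar_FV.
have oU : open (c @` cdom c) by have [] := tr c c Sc Sc; rewrite setIid.
split=> //; apply/(smooth_onP _ oU) => Y YU.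
apply: (smooth_at_eq (f := fun Y => (amx \o cinv c) Y *m invmx (emx e))).
  apply: filterS (open_nbhs_nbhs (conj oU YU)) => _ [ob cO <-].
  rewrite -[RHS]/(FV_chart A e (abar (cinv c (c ob)))) /= cinv_chart//.
  exact: (esym (FV_chartE eF (abar_FV (cP _ cO)))).
apply: smooth_at_mul; last exact: smooth_at_cst.
exact: (smooth_onP _ oU).1 (smooth_amx_cinv Sc) _ YU.
Qed.

(** The inverse of [abar]. From the chart of [e] it reads as right multiplication by [emx e]
    followed by [k \o orb]. *)
Lemma orb_emx_smooth :
  smooth_map (FV n A) (FV_charts n A) (Phi n A) S (orb \o emx).
Proof.
split=> [e /FVP[_ eu]|c k [e eF <-] Sd]; first exact: Phi_orb.
have /FVP[_ eu] := eF.
have locE Z : Z \in unitmx ->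
    loc (FV_chart A e) k (orb \o emx) Z = (k \o orb) (Z *m emx e).
  move=> Zu; rewrite -[LHS]/(k (orb (emx (cinv (FV_chart A e) Z)))).
  by rewrite cinv_FV_chart// emxK.
have smul Z : smooth_at Z (fun Z : 'M[R]_n => Z *m emx e).
  by apply: smooth_at_mul; [exact: smooth_at_id|exact: smooth_at_cst].
have -> : FV_chart A e @` (FV n A `&` (orb \o emx) @^-1` cdom k) =
    (fun Z => Z *m emx e) @^-1` orbdom k.
  apply/seteqP; split=> [_ [f [fF df] <-]|Z [Zu dZ]] /=.
    rewrite -(FV_chart_emx eF fF); split=> //=.
    by have /FVP[] := fF.
  have bF := basis_of_mx_FV Zu.
  exists (basis_of_mx (Z *m emx e)); last first.
    by apply: etrans (FV_chartE eF bF) _; rewrite emxK mulmxK.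
  by split=> //=; rewrite emxK.
have oU : open ((fun Z => Z *m emx e) @^-1` orbdom k).
  rewrite openE => Z /= dZ.
  exact: smooth_at_continuous (smul Z) _ (open_nbhs_nbhs (conj (open_orbdom Sd) dZ)).
split=> //; apply/(smooth_onP _ oU) => Z dZ.
apply: (smooth_at_eq (f := (k \o orb) \o (fun Z => Z *m emx e))).
  apply: filterS (open_nbhs_nbhs (conj oU dZ)) => Z' [/= Zu' _].
  by rewrite locE//; move: Zu'; rewrite unitmx_mul => /andP[].
by apply: smooth_at_comp (smul Z) _; exact: smooth_chart_orb.
Qed.

Lemma abar_diffeomorphism :
  diffeomorphism (Phi n A) S (FV n A) (FV_charts n A) abar.
Proof.
split; first exact: abar_smooth.
exists (orb \o emx); split; first exact: orb_emx_smooth.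
  by move=> O /set_mem OP; exact: (orb_amx OP).
move=> e /set_mem eF; have /FVP[_ eu] := eF.
by rewrite /= abar_orb// basis_of_mxK.
Qed.

End QuotientStructure.

Lemma abar_act g r : G A g -> FP A r ->
  abar (Horbit A (frame_act g r)) = (fun i => dA n A g (abar (Horbit A r) i)).
Proof.
by move=> gG rF; rewrite (abarE rF) (abarE (FP_act gG rF)) eps_act.
Qed.

End Frames.

(** * Coordinates adapted to [A], and the conclusion *)

Lemma exists_coordinates (R : realType) n (V : vectType R) (A : set V) :
  \dim (fullv : {vspace V}) = n.+1 -> Pn A ->
  exists (vec : {linear 'rV[R]_n.+1 -> V}) (crd : {linear V -> 'rV[R]_n.+1}),
    [/\ cancel vec crd, cancel crd vec & A = pt (vec e0)].
Proof.
move=> hV [a a0 ->].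
have b0 : basis_of fullv (vbasis (fullv : {vspace V})) := vbasisP _.
move: (vbasis _) b0; rewrite hV => b bP.
pose v0 (u : 'rV[R]_n.+1) : V := \sum_i u 0 i *: b`_i.
pose c0 (v : V) : 'rV[R]_n.+1 := \row_i coord b i v.
have fb := basis_free bP.
have v0K : cancel v0 c0.
  by move=> u; apply/rowP => i; rewrite mxE coord_sum_free.
have c0K : cancel c0 v0.
  move=> v; rewrite [RHS](coord_basis bP (memvf v)).
  by apply: eq_bigr => i _; rewrite mxE.
have aN : c0 a != 0.
  apply/eqP => h; move: a0; rewrite -(c0K a) h /v0 big1 ?eqxx// => i _.
  by rewrite mxE scale0r.
(* The basis [b] ignores [A]; the change of basis [B] makes [e0] the coordinates of [a]. *)
have [B Bu BE] := exists_unit_row aN.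
have vlin : linear (fun u : 'rV[R]_n.+1 => v0 (u *m B)).
  move=> k u w; rewrite mulmxDl -scalemxAl /v0 scaler_sumr -big_split /=.
  by apply: eq_bigr => i _; rewrite !mxE scalerDl scalerA.
have clin : linear (fun v => c0 v *m invmx B).
  move=> k v w; rewrite scalemxAl -mulmxDl; congr (_ *m _).
  by apply/rowP => i; rewrite !mxE linearP.
pose vec : {linear 'rV[R]_n.+1 -> V} :=
  HB.pack (fun u : 'rV[R]_n.+1 => v0 (u *m B)) (GRing.isLinear.Build _ _ _ _ _ vlin).
pose crd : {linear V -> 'rV[R]_n.+1} :=
  HB.pack (fun v => c0 v *m invmx B) (GRing.isLinear.Build _ _ _ _ _ clin).
exists vec, crd; split=> [u|v|]; rewrite /vec /crd /=.
- by rewrite v0K mulmxK.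
- by rewrite mulmxKV// c0K.
- by rewrite BE c0K.
Qed.

Theorem theorem1 (R : realType) (n : nat) (V : vectType R) (A : set V)
  (hn : (1 <= n)%N) (hV : \dim (fullv : {vspace V}) = n.+1) (hA : Pn A) :
  exists abar : set (frame n V) -> ('I_n -> tangentA n V),
    [/\ forall r : frame n V, FP A r -> abar (Horbit A r) = eps A r,
        exists S : set (chart (set (frame n V)) 'M[R]_n),
          quotient_structure A S,
        forall S : set (chart (set (frame n V)) 'M[R]_n),
          quotient_structure A S ->
          diffeomorphism (Phi n A) S (FV n A) (FV_charts n A) abar &
        forall (g : set V -> set V) (r : frame n V),
          G A g -> FP A r ->
          abar (Horbit A (frame_act g r)) =
            (fun i => dA n A g (abar (Horbit A r) i))].
Proof.
have [vec [crd [vecK crdK ->]]] := exists_coordinates hV hA.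
exists (abar vec); split.
- by move=> r; exact: (abarE vecK crdK hV).
- by exists [set amx_chart vec]; exact: (quotient_structure_amx vecK crdK hV).
- by move=> S; exact: (abar_diffeomorphism vecK crdK hV).
- by move=> g r; exact: (abar_act vecK crdK hV).
Qed.
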